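(* Consider the power network with frequency-dependent on-off loads and the associated Filippov differential inclusion $\dot x\in Q(x)$ on $\mathbb{R}^n$, $n=|E|+2|N|$, defined in the context. Then, for all initial conditions $x(0)\in\mathbb{R}^n$, the Filippov solutions $x(t)$ of the system converge (as $t\to\infty$) to an equilibrium point, i.e. to a point $x^*\in\mathbb{R}^n$ with $\mathbf{0}_n\in Q(x^* )$ (the limit equilibrium may depend on the solution).
   Context: Network: $(N,E)$ is a finite connected graph with bus set $N=\{1,\dots,|N|\}$ and line set $E\subseteq N\times N$, directed with an arbitrary orientation so that $(i,j)\in E$ implies $(j,i)\notin E$. For $j\in N$, $N^i_j$ and $N^o_j$ are the sets of predecessors and successors of $j$, i.e. $N^i_j=\{i:(i,j)\in E\}$, $N^o_j=\{k:(j,k)\in E\}$. Constants: $B_{ij}>0$ for $(i,j)\in E$; $M_j,\tau_j,A_j,\alpha_j>0$ and $p^L_j\in\mathbb{R}$ for $j\in N$. On-off loads: for each $j\in N$ there are constants $-\infty<\underline d_j\le 0\le\overline d_j<\infty$ and $\overline\omega_j>0>\underline\omega_j$, and a controllable demand $d^c_j=f^d_j(\omega_j)$, where $f^d_j(\omega_j)=\overline d_j$ if $\omega_j>\overline\omega_j$; $=0$ if $\underline\omega_j<\omega_j\le\overline\omega_j$; $=\underline d_j$ if $\omega_j\le\underline\omega_j$. Its Filippov set-valued map is $F[d^c_j(\omega_j)]=[0,\overline d_j]$ if $\omega_j=\overline\omega_j$, $[\underline d_j,0]$ if $\omega_j=\underline\omega_j$, and $\{f^d_j(\omega_j)\}$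 otherwise. State: $x=(\eta,\omega,p^M)\in\mathbb{R}^{|E|}\times\mathbb{R}^{|N|}\times\mathbb{R}^{|N|}=\mathbb{R}^n$. With $p_{ij}=B_{ij}\eta_{ij}$ for $(i,j)\in E$, $Q(x)\subseteq\mathbb{R}^n$ is the set of all vectors $(\dot\eta,\dot\omega,\dot p^M)$ with - $\dot\eta_{ij}=\omega_i-\omega_j$ for $(i,j)\in E$; - $\dot\omega_j=\frac{1}{M_j}\big(-p^L_j+p^M_j-A_j\omega_j-v_j-\sum_{k\in N^o_j}p_{jk}+\sum_{i\in N^i_j}p_{ij}\big)$ for some $v_j\in F[d^c_j(\omega_j)]$, for $j\in N$; - $\dot p^M_j=-\frac{1}{\tau_j}(p^M_j+\alpha_j\omega_j)$ for $j\in N$. A Filippov solution on an interval $[0,t_1]$ is an absolutely continuous map $x:[0,t_1]\to\mathbb{R}^n$ with $\dot x(t)\in Q(x(t))$ for almost all $t\in[0,t_1]$; the convergence statement refers to solutions defined on $[0,\infty)$ (absolutely continuous on each compact interval $[0,t_1]$). An equilibrium is a point $x^*$ with $\mathbf{0}_n\in Q(x^* )$. *)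

(* Defs.v *)
From mathcomp Require Import all_boot all_order all_algebra.
From mathcomp Require Import all_classical all_reals all_analysis.

Set Implicit Arguments.
Unset Strict Implicit.
Unset Printing Implicit Defensive.

Import Order.TTheory GRing.Theory Num.Theory.
Import numFieldNormedType.Exports.

Local Open Scope classical_set_scope.
Local Open Scope ring_scope.

(* Antisymmetry of [line] also rules out self-loops. The value of [B i j] is
   irrelevant when (i, j) is not a line. *)
Record power_network (R : realType) (n : nat) := PowerNetwork {
  line : {set 'I_n * 'I_n};
  line_oriented : forall i j, (i, j) \in line -> (j, i) \notin line;
  line_connected : forall i j,
    connect (fun a b => ((a, b) \in line) || ((b, a) \in line)) i j;
  B : 'I_n -> 'I_n -> R;
  B_gt0 : forall i j, (i, j) \in line -> 0 < B i j;
  M : 'I_n -> R;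
  M_gt0 : forall j, 0 < M j;
  tau : 'I_n -> R;
  tau_gt0 : forall j, 0 < tau j;
  A : 'I_n -> R;
  A_gt0 : forall j, 0 < A j;
  alpha : 'I_n -> R;
  alpha_gt0 : forall j, 0 < alpha j;
  pL : 'I_n -> R;
  d_lo : 'I_n -> R;
  d_lo_le0 : forall j, d_lo j <= 0;
  d_hi : 'I_n -> R;
  d_hi_ge0 : forall j, 0 <= d_hi j;
  w_lo : 'I_n -> R;
  w_lo_lt0 : forall j, w_lo j < 0;
  w_hi : 'I_n -> R;
  w_hi_gt0 : forall j, 0 < w_hi j
}.

Section PowerNetworkDynamics.
Context (R : realType) (n : nat) (G : power_network R n).

Definition predecessors (j : 'I_n) : {set 'I_n} := [set i | (i, j) \in line G]%SET.

Definition successors (j : 'I_n) : {set 'I_n} := [set k | (j, k) \in line G]%SET.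

Definition onoff_load (j : 'I_n) (w : R) : R :=
  if w_hi G j < w then d_hi G j
  else if w_lo G j < w then 0
  else d_lo G j.

Definition filippov_load (j : 'I_n) (w : R) : set R :=
  if w == w_hi G j then [set` `[0, d_hi G j]]
  else if w == w_lo G j then [set` `[d_lo G j, 0]]
  else [set onoff_load j w].

(* R^|E| x R^|N| x R^|N|; coordinates of the first factor follow the
   enumeration of the lines. *)
Definition state : normedModType R :=
  ('rV[R]_#|line G| * 'rV[R]_n * 'rV[R]_n)%type.

(* The coordinate of [eta] at the line (i, j): for (i, j) in [line G] the sum
   has exactly one term, since [enum_val] is a bijection onto the lines; it is
   empty, hence 0, otherwise. *)
Definition at_line (eta : 'rV[R]_#|line G|) (i j : 'I_n) : R :=
  \sum_(l < #|line G| | enum_val l == (i, j)) eta 0 l.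

Definition eta (x : state) (i j : 'I_n) : R := at_line x.1.1 i j.
Definition omega (x : state) (j : 'I_n) : R := x.1.2 0 j.
Definition pM (x : state) (j : 'I_n) : R := x.2 0 j.

Definition power (x : state) (i j : 'I_n) : R := B G i j * eta x i j.

Definition Q (x : state) : set state := [set dx |
  [/\ forall i j, (i, j) \in line G -> eta dx i j = omega x i - omega x j,
      forall j, exists2 v, filippov_load j (omega x j) v &
        omega dx j = (M G j)^-1 *
          (- pL G j + pM x j - A G j * omega x j - v
           - \sum_(k in successors j) power x j k
           + \sum_(i in predecessors j) power x i j)
    & forall j,
        pM dx j = - (tau G j)^-1 * (pM x j + alpha G j * omega x j)]].

Definition equilibrium (x : state) : Prop := Q x 0.

End PowerNetworkDynamics.

Definition absolutely_continuous (R : realType) (V : normedModType R)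
    (a b : R) (f : R -> V) : Prop :=
  forall eps : R, 0 < eps -> exists2 delta : R, 0 < delta &
    forall (m : nat) (u v : 'I_m -> R),
      (forall k, [/\ a <= u k, u k <= v k & v k <= b]) ->
      trivIset [set: 'I_m] (fun k => [set` `]u k, v k[]) ->
      \sum_(k < m) (v k - u k) < delta ->
      \sum_(k < m) `|f (v k) - f (u k)| < eps.

(* Only the values of [x] on [0, t1] matter: the two-sided derivative sees the
   other values only at the two end points, which form a null set. *)
Definition filippov_solution_on (R : realType) (n : nat)
    (G : power_network R n) (t1 : R) (x : R -> state G) : Prop :=
  absolutely_continuous 0 t1 x /\
  {ae lebesgue_measure, forall t : R, 0 <= t <= t1 ->
    derivable x t 1 /\ Q (x t) ('D_1 x t)}.

Definition filippov_solution (R : realType) (n : nat)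
    (G : power_network R n) (x : R -> state G) : Prop :=
  forall t1 : R, 0 < t1 -> filippov_solution_on t1 x.

(* Main.v *)
(* Let xs be an equilibrium and V the weighted squared distance to it. Because
   the Filippov loads are monotone, V decreases along solutions at a rate bounded
   below by a quadratic form in the deviations of omega and pM; hence solutions
   are bounded, omega and pM are Lipschitz, and a Barbalat argument makes them
   converge to their values at xs. The flows eta are only known to be bounded,
   but at a cluster point of eta the power imbalance must be an admissible load,
   for otherwise a frequency would drift by a fixed amount in unit time. So the
   cluster point is itself an equilibrium, and the function V attached to it is
   nonincreasing and arbitrarily small, hence tends to 0. *)

Require Import Defs.
From mathcomp Require Import all_boot all_order all_algebra.
From mathcomp Require Import all_classical all_reals all_analysis.
From mathcomp Require Import ring lra.

Set Implicit Arguments.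
Unset Strict Implicit.
Unset Printing Implicit Defensive.

Import Order.TTheory GRing.Theory Num.Theory.
Import numFieldNormedType.Exports.

Local Open Scope classical_set_scope.
Local Open Scope ring_scope.

(** * Monotonicity from an almost everywhere derivative bound *)

(** Equilibria are not isolated: flows are fixed only up to circulations around cycles, and at a
    threshold frequency the load may be any point of an interval. Decay of [lyapunov] for one fixed
    equilibrium therefore cannot identify the limit of the flows. What saves the argument is that
    the same formula works for every equilibrium, while [omega] and [pM] have the same limits
    whichever equilibrium is used; so the right equilibrium can be built afterwards, from the
    trajectory itself. An invariance principle would require limits of solutions; here one
    trajectory is watched over a unit of time, during which the flows hardly move because the
    frequencies at the two ends of a line have nearly merged. Velocities are discontinuous and exist
    only almost everywhere, so every estimate is reduced to a bound on the increment of an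
    absolutely continuous function, proved by a covering argument instead of integration. *)

(* Cousin's lemma. *)
Lemma interval_induction (R : realType) (P : R -> R -> Prop) (a b : R) :
  a <= b ->
  (forall u v w, u <= v -> v <= w -> P u v -> P v w -> P u w) ->
  (forall t, a <= t <= b -> exists2 d, 0 < d & forall u v,
     a <= u -> v <= b -> t - d < u -> u <= t -> t <= v -> v < t + d -> P u v) ->
  P a b.
Proof.
move=> ab Pcat Ploc.
set S := [set t | a <= t <= b /\ P a t].
have Sa : S a.
  split; first by rewrite lexx.
  have [|d d0 Pd] := Ploc a; first by rewrite lexx.
  by apply: Pd; rewrite ?lexx// ?ltrBlDr ltrDl.
have Sub : has_ubound S by exists b => t [/andP[]].
have hS : has_sup S by split => //; exists a.
have aS : a <= sup S by apply: ub_le_sup.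
have Sb : sup S <= b by apply: ge_sup; [exists a|move=> t [/andP[]]].
have [|d d0 Pd] := Ploc (sup S); first by rewrite aS.
have [t [/andP[a_t tb] Pat] St] := sup_adherent d0 hS.
have tS : t <= sup S by apply: ub_le_sup => //; split=> //; rewrite a_t.
have PaS : P a (sup S).
  by apply: Pcat Pat _ => //; apply: Pd; rewrite ?ltrDl.
have [Slt|] := ltP (sup S) b; last first.
  by move=> bS; have <- : sup S = b by apply/le_anti; rewrite Sb.
set v := Num.min b (sup S + d / 2).
have Sv : sup S < v by rewrite lt_min Slt/= ltrDl divr_gt0.
have vb : v <= b by rewrite ge_min lexx.
have : v <= sup S.
  apply: ub_le_sup => //; split; first by rewrite vb (le_trans aS (ltW Sv)).
  apply: (Pcat _ (sup S)) => //; first exact: ltW.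
  apply: Pd => //; [by lra|exact: ltW|].
  by rewrite gt_min; apply/orP; right; lra.
by rewrite leNgt Sv.
Qed.

Lemma is_derive_near (R : realType) (f : R -> R) (t D e : R) :
  is_derive t 1 f D -> 0 < e -> exists2 d, 0 < d &
  forall s, `|s - t| < d -> `|f s - f t - D * (s - t)| <= e * `|s - t|.
Proof.
move=> [fd fD] e0.
move: fd; rewrite /derivable => /cvgrPdist_le /(_ e e0).
rewrite near_withinE -/(derive _ _ _) fD => /nbhs_normP [d d0 dP].
exists d => // s std; have [->|st] := eqVneq s t.
  by rewrite !subrr mulr0 subrr normr0 mulr0.
have s0 : s - t != 0 by rewrite subr_eq0.
have /= := dP (s - t); rewrite sub0r normrN => /(_ std s0).
rewrite /GRing.scale/= mulr1 subrK => h.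
have -> : f s - f t - D * (s - t) =
    - (D - (s - t)^-1 * (f s - f t)) * (s - t) by field.
by rewrite normrM normrN ler_wpM2r.
Qed.

(** Ordered intervals inside [U], with gaps allowed. A list makes concatenation match the gluing
    step of Cousin's lemma; half-open intervals keep neighbours disjoint, so that lengths add up to
    at most the measure of [U]. *)
Fixpoint chain {R : realType} (U : set R) (a b : R) (s : seq (R * R)) : Prop :=
  if s is p :: s' then
    [/\ a <= p.1, p.1 <= p.2, [set` `[p.1, p.2[] `<=` U & chain U p.2 b s']
  else a <= b.

Lemma chain_le {R : realType} {U : set R} {a b : R} {s} : chain U a b s -> a <= b.
Proof.
elim: s a => [|p s ih] a //= [ap pp _ /ih]; exact: le_trans (le_trans ap pp).
Qed.

Lemma chain_lel {R : realType} {U : set R} {a a' b : R} {s} :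
  a' <= a -> chain U a b s -> chain U a' b s.
Proof.
case: s => [|p s] /= aa; first exact: le_trans.
by move=> [? ? ? ?]; split=> //; exact: le_trans aa _.
Qed.

Lemma chain_sub {R : realType} {U U' : set R} {a b : R} {s} :
  U `<=` U' -> chain U a b s -> chain U' a b s.
Proof.
move=> UU'; elim: s a => //= p s ih a [? ? pU /ih]; split=> //.
exact: subset_trans UU'.
Qed.

Lemma chain_cat {R : realType} {U : set R} {a b c : R} {s s'} :
  chain U a b s -> chain U b c s' -> chain U a c (s ++ s').
Proof.
elim: s a => [|p s ih] a /= => [ab|[? ? ? h] /(ih _ h)//]; exact: chain_lel.
Qed.

Lemma chain_mem {R : realType} {U : set R} {a b : R} {s p} :
  chain U a b s -> p \in s -> [/\ a <= p.1, p.1 <= p.2 & p.2 <= b].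
Proof.
elim: s a => [|q s ih] a //= [aq qq _ h]; rewrite inE => /predU1P[->|/(ih _ h)[]].
  by split => //; exact: chain_le h.
by move=> qp pp pb; split=> //; apply: le_trans (le_trans aq qq) qp.
Qed.

Lemma chain_nth {R : realType} {U : set R} {a b : R} {s} (p0 : R * R) {i j} :
  chain U a b s -> (i < j < size s)%N -> (nth p0 s i).2 <= (nth p0 s j).1.
Proof.
elim: s a i j => [|q s ih] a i [|j]//=; rewrite ?andbF// => -[_ _ _ h].
case: i => [|i] /= ij; last exact: ih h ij.
by case: (chain_mem h (mem_nth p0 (ij : (j < size s)%N))).
Qed.

(** The first interval and the part of [U] beyond it are disjoint, so measures add along the
    induction. *)
Lemma chain_measure {R : realType} {U : set R} {a b : R} {s} :
  measurable U -> chain U a b s ->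
  ((\sum_(p <- s) (p.2 - p.1))%:E <= lebesgue_measure (U `&` `[a, b[%classic))%E.
Proof.
move=> mU; elim: s a => [|p s ih] a /=; first by rewrite big_nil.
move=> [ap pp pU h]; rewrite big_cons EFinD.
have pb := chain_le h.
have mI x y : measurable (U `&` `[x, y[%classic).
  by apply: measurableI => //; exact: measurable_itv.
apply: le_trans (leeD2l _ (ih _ h)) _.
have -> : (p.2 - p.1)%:E = lebesgue_measure `[p.1, p.2[%classic.
  rewrite lebesgue_measure_itv/= lte_fin; case: ltP => // e.
  by have -> : p.1 = p.2 by [apply/le_anti; rewrite pp]; rewrite subrr.
have mp : measurable [set` `[p.1, p.2[] by exact: measurable_itv.
have dis : [set` `[p.1, p.2[] `&` (U `&` `[p.2, b[%classic) = set0.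
  by rewrite -subset0 => x [/=] + [_ /=]; rewrite !in_itv/=; lra.
rewrite -(measureU lebesgue_measure mp (mI _ _) dis).
apply: (le_measure lebesgue_measure).
- by apply: mem_set; apply: measurableU => //; exact: mI.
- by apply: mem_set; exact: mI.
move=> x /= []; first by move=> xp; split; [exact: pU|move: xp; rewrite !in_itv/=; lra].
by move=> [Ux]; rewrite !in_itv/= => xpb; split => //; move: xpb; lra.
Qed.

(** Absolute continuity speaks of indexed families of disjoint open intervals; a chain is one
    because its intervals come in order. *)
Lemma ac_chain {R : realType} {V : normedModType R} {U : set R} {a b : R}
    {f : R -> V} {eps : R} :
  absolutely_continuous a b f -> 0 < eps -> exists2 delta, 0 < delta &
  forall s, chain U a b s -> \sum_(p <- s) (p.2 - p.1) < delta ->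
    \sum_(p <- s) `|f p.2 - f p.1| < eps.
Proof.
move=> acf eps0; have [delta d0 dP] := acf _ eps0.
exists delta => // s cs; rewrite !(big_nth (0, 0)) !big_mkord.
apply: dP => [k|]; first exact: chain_mem cs (mem_nth _ (ltn_ord k)).
apply/trivIsetP => i j _ _ ij; wlog lij : i j ij / (i < j)%N => [hw|].
  have := ij; rewrite -val_eqE neq_ltn => /orP[|ji]; first exact: hw.
  by rewrite setIC; apply: hw => //; rewrite eq_sym.
have h : (nth (0, 0) s i).2 <= (nth (0, 0) s j).1.
  by apply: chain_nth cs _; rewrite lij ltn_ord.
by rewrite -subset0 => x [/=]; rewrite !in_itv/=; lra.
Qed.

(* Cover the null set of bad points by an open set of small measure and cut
   [[a, b]] into intervals around good points, where the derivative controls the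
   increment, and intervals inside the open set, where absolute continuity does. *)
Lemma ac_increment_le {R : realType} {a b c : R} {f : R -> R} :
  a <= b -> absolutely_continuous a b f ->
  {ae lebesgue_measure, forall t, a <= t <= b ->
     exists2 D, is_derive t 1 f D & D <= c} ->
  f b - f a <= c * (b - a).
Proof.
move=> ab acf [N [mN N0 subN]].
suff H e : 0 < e -> f b - f a <= c * (b - a) + e * (b - a + 2).
  apply/ler_addgt0Pr => e e0; have ba : 0 < b - a + 2 by lra.
  by have := H (e / (b - a + 2)) (divr_gt0 e0 ba); rewrite divfK// gt_eqF.
(* [C] is at least [- (c + e)], which pays for a negative slope on the intervals inside [U]. The
   total error [e * (b - a + 2)] collects the excess slope, the variation of [f] inside [U] and the
   term in [C], each of the last two being at most [e]. *)
move=> e0; pose C := `|c| + e.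
have C0 : 0 < C by rewrite ltr_wpDl.
have Cc : - C <= c + e by rewrite /C; have := ler_norm (- c); rewrite normrN; lra.
have [delta d0 dP] := @ac_chain R R setT a b f e acf e0.
pose delta' := Num.min delta (e / C).
have d'0 : 0 < delta' by rewrite lt_min d0 divr_gt0.
have [U [oU NU Ud]] : exists U, [/\ open U, N `<=` U &
    (lebesgue_measure (U `\` N) < delta'%:E)%E].
  by apply: lebesgue_regularity_outer => //; rewrite [ltLHS]N0.
have mU : measurable U by exact: measurable_realfun.open_measurable.
have Ud' : (lebesgue_measure U < delta'%:E)%E.
  rewrite -(setDUK NU) measureU//; [|exact: measurableD|exact: setDIK].
  by rewrite [X in (X + _)%E](N0 : lebesgue_measure N = 0%E) add0e.
(* The bound is additive under concatenation, as Cousin's lemma requires; an interval around a good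
   point contributes nothing to [s]. *)
pose P u v := exists2 s, chain U u v s &
  f v - f u <= (c + e) * (v - u) + \sum_(p <- s) `|f p.2 - f p.1|
     + C * \sum_(p <- s) (p.2 - p.1).
suff [s cs fs] : P a b.
  have sl : \sum_(p <- s) (p.2 - p.1) < delta'.
    rewrite -lte_fin; apply: le_lt_trans (chain_measure mU cs) _.
    apply: le_lt_trans Ud'; apply: (le_measure lebesgue_measure).
    - by apply: mem_set; apply: measurableI => //; exact: measurable_itv.
    - exact: mem_set.
    - exact: subIsetl.
  have sf : \sum_(p <- s) `|f p.2 - f p.1| < e.
    apply: dP.
      exact: chain_sub (subsetT U) cs.
    by apply: lt_le_trans sl _; rewrite ge_min lexx.
  have Cs : C * \sum_(p <- s) (p.2 - p.1) <= e.
    rewrite mulrC -ler_pdivlMr//; apply: le_trans (ltW sl) _.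
    by rewrite ge_min lexx orbT.
  by move: fs; lra.
apply: interval_induction => //.
  move=> u v w uv vw [s cs hs] [s' cs' hs'].
  exists (s ++ s'); first exact: chain_cat cs cs'.
  by rewrite !big_cat/= mulrDr; lra.
move=> t tab; have [Nt|Nt] := pselect (N t).
  have /nbhs_ballP[d /= d1 dU] := open_nbhs_nbhs (conj oU (NU _ Nt)).
  exists d => // u v au vb dt ut tv vd; exists [:: (u, v)].
    split=> //=; first by rewrite (le_trans ut tv).
    move=> x; rewrite /= in_itv/= => xuv; apply: dU.
    by rewrite /ball/= ltr_distl; lra.
  rewrite !big_seq1/=; have := ler_norm (f v - f u).
  have : 0 <= (C + (c + e)) * (v - u) by rewrite mulr_ge0//; lra.
  by rewrite mulrDl; lra.
have [D fD Dc] : exists2 D, is_derive t 1 f D & D <= c.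
  apply: contrapT => h; apply: Nt; apply: subN => /= h'; exact: h (h' tab).
have [d d1 dD] := is_derive_near fD e0.
exists d => // u v au vb dt ut tv vd; exists [::] => /=; first exact: le_trans ut tv.
rewrite !big_nil mulr0 !addr0.
have := dD u; rewrite ler0_norm; last lra.
have := dD v; rewrite ger0_norm; last lra.
move=> /(_ _)/wrap[]; first lra. move=> h1.
move=> /(_ _)/wrap[]; first lra. move=> h2.
move: (ler_norm (f v - f t - D * (v - t))) (ler_norm (- (f u - f t - D * (u - t)))).
rewrite normrN => h3 h4.
have : 0 <= (c - D) * (v - u) by rewrite mulr_ge0//; lra.
rewrite mulrBl !(mulrDl, mulrBr); move: h1 h2 h3 h4; rewrite !mulrBr; lra.
Qed.

(** * Absolutely continuous functions *)

(** Two dominating functions are allowed so that sums and products are both instances. *)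
Lemma ac_dominated {R : realType} {V W Z : normedModType R} {a b K : R}
    {f : R -> V} {g : R -> W} {h : R -> Z} :
  absolutely_continuous a b f -> absolutely_continuous a b g -> 0 <= K ->
  (forall u v, a <= u -> u <= v -> v <= b ->
     `|h v - h u| <= K * (`|f v - f u| + `|g v - g u|)) ->
  absolutely_continuous a b h.
Proof.
move=> acf acg K0 hK e e0.
have K1 : 0 < K *+ 2 + 1 by rewrite ltr_wpDl// mulrn_wge0.
pose e' := e / (K *+ 2 + 1).
have e'0 : 0 < e' by rewrite divr_gt0.
have [d d0 fd] := acf _ e'0; have [d' d'0 gd] := acg _ e'0.
exists (Num.min d d'); first by rewrite lt_min d0.
move=> m u v uv tuv; rewrite lt_min => /andP[sd sd'].
have {fd} := fd m u v uv tuv sd; have {gd} := gd m u v uv tuv sd'.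
set sg := (X in X < _ -> _) => hg; set sf := (X in X < _ -> _) => hf.
have : \sum_(k < m) `|h (v k) - h (u k)| <= K * (sf + sg).
  rewrite -big_split mulr_sumr/=; apply: ler_sum => k _.
  by have [? ? ?] := uv k; exact: hK.
move=> /le_lt_trans; apply.
have -> : e = (K *+ 2 + 1) * e' by rewrite mulrC divfK// gt_eqF.
have : K * (sf + sg) <= K * (e' + e') by rewrite ler_wpM2l// lerD ?ltW.
by rewrite mulr2n; lra.
Qed.

Lemma ac_subitv {R : realType} {V : normedModType R} {a b a' b' : R} {f : R -> V} :
  a <= a' -> b' <= b -> absolutely_continuous a b f ->
  absolutely_continuous a' b' f.
Proof.
move=> aa bb acf e /acf[d d0 dP]; exists d => // m u v uv.
apply: dP => k; have [? ? ?] := uv k.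
by split => //; [exact: le_trans aa _|exact: le_trans bb].
Qed.

Lemma ac_cst {R : realType} {V : normedModType R} (a b : R) (c : V) :
  absolutely_continuous a b (fun=> c).
Proof.
move=> e e0; exists 1 => // m u v _ _ _.
by rewrite big1// => k _; rewrite subrr normr0.
Qed.

Lemma acD {R : realType} {V : normedModType R} {a b : R} {f g : R -> V} :
  absolutely_continuous a b f -> absolutely_continuous a b g ->
  absolutely_continuous a b (fun t => f t + g t).
Proof.
move=> acf acg; apply: (ac_dominated acf acg ler01) => u v _ _ _.
by rewrite opprD addrACA mul1r ler_normD.
Qed.

Lemma acN {R : realType} {V : normedModType R} {a b : R} {f : R -> V} :
  absolutely_continuous a b f -> absolutely_continuous a b (fun t => - f t).
Proof.
move=> acf; apply: (ac_dominated acf acf ler01) => u v _ _ _.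
by rewrite -opprD normrN mul1r lerDl.
Qed.

Lemma ac_sum {R : realType} {V : normedModType R} (a b : R) (I : Type)
    (r : seq I) (P : pred I) (F : I -> R -> V) :
  (forall i, absolutely_continuous a b (F i)) ->
  absolutely_continuous a b (fun t => \sum_(i <- r | P i) F i t).
Proof.
move=> acF; elim: r => [|i r ih].
  by rewrite (_ : (fun _ => _) = fun=> 0); [exact: ac_cst|apply/funext => t; rewrite big_nil].
have [Pi|Pi] := boolP (P i); last first.
  by rewrite (_ : (fun _ => _) = fun t => \sum_(j <- r | P j) F j t)//;
    apply/funext => t; rewrite big_cons (negbTE Pi).
rewrite (_ : (fun _ => _) = fun t => F i t + \sum_(j <- r | P j) F j t); first exact: acD.
by apply/funext => t; rewrite big_cons Pi.
Qed.

Lemma ac_near {R : realType} {V : normedModType R} {a b : R} {f : R -> V} {eps : R} :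
  absolutely_continuous a b f -> 0 < eps -> exists2 delta, 0 < delta &
  forall s t, a <= s <= b -> a <= t <= b -> `|s - t| < delta -> `|f s - f t| < eps.
Proof.
move=> acf e0; have [d d0 dP] := ac_chain (U := setT) acf e0.
exists d => // s t; wlog st : s t / t <= s => [hw sab tab std|].
  have [/ltW ts|ts] := ltP s t; last exact: hw.
  by rewrite distrC; apply: hw => //; rewrite distrC.
move=> /andP[a_s sb] /andP[a_t tb]; rewrite ger0_norm ?subr_ge0// => std.
have := dP [:: (t, s)]; rewrite !big_seq1/=; apply => //; split => //.
Qed.

(** Boundedness passes to concatenations and holds locally by [ac_near], so Cousin's lemma
    applies. *)
Lemma ac_bounded {R : realType} {V : normedModType R} {a b : R} {f : R -> V} :
  absolutely_continuous a b f ->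
  exists C, forall t, a <= t <= b -> `|f t| <= C.
Proof.
move=> acf; have [ab|ba] := leP a b; last by exists 0 => t; lra.
have [d d0 dP] := ac_near acf ltr01.
apply: (@interval_induction R
  (fun u v => exists C, forall t, u <= t <= v -> `|f t| <= C)) => //.
- move=> u v w uv vw [C hC] [C' hC']; exists (Num.max C C') => t /andP[ut tw].
  have [tv|vt] := leP t v; rewrite le_max; first by rewrite hC ?ut.
  by rewrite hC' ?orbT// (ltW vt).
- move=> t tab; exists d => // u v au vb tu ut tv vt.
  exists (`|f t| + 1) => s sut; rewrite -lerBlDl.
  apply: le_trans (lerB_dist _ _) _; apply/ltW/dP => //; first lra.
  by rewrite ltr_distl; lra.
Qed.

Lemma acM {R : realType} {a b : R} {f g : R -> R} :
  absolutely_continuous a b f -> absolutely_continuous a b g ->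
  absolutely_continuous a b (fun t => f t * g t).
Proof.
move=> acf acg; have [C hC] := ac_bounded acf; have [C' hC'] := ac_bounded acg.
apply: (@ac_dominated _ _ _ _ _ _ (`|C| + `|C'|) _ _ _ acf acg) => [|u v au uv vb].
  by rewrite addr_ge0.
rewrite (_ : f v * g v - f u * g u =
   f v * (g v - g u) + (f v - f u) * g u); last ring.
apply: le_trans (ler_normD _ _) _; rewrite !normrM.
have h1 : `|f v| <= `|C| by apply: le_trans (ler_norm C); apply: hC; lra.
have h2 : `|g u| <= `|C'| by apply: le_trans (ler_norm C'); apply: hC'; lra.
have h3 : `|f v| * `|g v - g u| <= `|C| * `|g v - g u| by rewrite ler_wpM2r.
have h4 : `|f v - f u| * `|g u| <= `|f v - f u| * `|C'| by rewrite ler_wpM2l.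
have h5 : 0 <= `|C| * `|f v - f u| by rewrite mulr_ge0.
have h6 : 0 <= `|C'| * `|g v - g u| by rewrite mulr_ge0.
lra.
Qed.

Lemma ac_bounded_linear {R : realType} {V : normedModType R} {a b K : R} {f : R -> V}
    {phi : V -> R} :
  (forall x y, phi (x - y) = phi x - phi y) -> (forall x, `|phi x| <= K * `|x|) ->
  absolutely_continuous a b f -> absolutely_continuous a b (phi \o f).
Proof.
move=> phiB phiK acf; apply: (ac_dominated acf acf (normr_ge0 K)) => u v _ _ _ /=.
rewrite -phiB; apply: le_trans (phiK _) _.
apply: le_trans (ler_wpM2r (normr_ge0 _) (ler_norm K)) _.
by rewrite ler_wpM2l// lerDl.
Qed.

Lemma is_derive_bounded_linear {R : realType} {V : normedModType R} {K t : R} {f : R -> V}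
    {D : V} {phi : V -> R} :
  (forall x y, phi (x - y) = phi x - phi y) ->
  (forall c x, phi (c *: x) = c * phi x) -> (forall x, `|phi x| <= K * `|x|) ->
  is_derive t 1 f D -> is_derive t 1 (phi \o f) (phi D).
Proof.
move=> phiB phiZ phiK [fd fD].
have K1 : 0 < `|K| + 1 by rewrite ltr_wpDl.
suff H : h^-1 *: (((phi \o f) \o shift t) (h *: 1) - (phi \o f) t) @[h --> 0^'] --> phi D.
  split; [by apply/cvg_ex; exists (phi D)|exact: (cvg_lim _ H)].
move: fd; rewrite /derivable -/('D_1 f t) fD => /cvgrPdist_lt fd.
apply/cvgrPdist_lt => e e0.
have := fd (e / (`|K| + 1)) (divr_gt0 e0 K1).
apply: filterS => h hf; rewrite /GRing.scale/= -phiB -phiZ -phiB.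
apply: le_lt_trans (phiK _) _.
rewrite ltr_pdivlMr// mulrC in hf; apply: le_lt_trans hf.
by apply: ler_wpM2r => //; apply: le_trans (ler_norm K) _; rewrite lerDl.
Qed.

(** * On-off loads *)

Section OnOffLoad.
Context {R : realType} {n : nat} (G : power_network R n).
Implicit Types (j : 'I_n) (w v : R).

(** [load_min] and [load_max] are the left and right limits of [onoff_load]. They turn membership in
    the Filippov set into two linear inequalities, so the lemmas below reduce to comparing
    frequencies with the thresholds. *)
Definition load_min j w : R :=
  if w == w_hi G j then 0 else if w == w_lo G j then d_lo G j
  else onoff_load G j w.

Definition load_max j w : R :=
  if w == w_hi G j then d_hi G j else if w == w_lo G j then 0
  else onoff_load G j w.

Lemma filippov_loadE j w v :
  filippov_load G j w v <-> load_min j w <= v <= load_max j w.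
Proof.
rewrite /filippov_load /load_min /load_max.
case: eqP => _; first by rewrite /= in_itv.
case: eqP => _; first by rewrite /= in_itv.
by split => [->|/le_anti]; rewrite ?lexx.
Qed.

Lemma load_min_max j w : load_min j w <= load_max j w.
Proof.
rewrite /load_min /load_max; case: eqP => _; first exact: d_hi_ge0.
by case: eqP => _ //; exact: d_lo_le0.
Qed.

Lemma filippov_load_onoff j w : filippov_load G j w (onoff_load G j w).
Proof.
have := (w_lo_lt0 G j, w_hi_gt0 G j, d_lo_le0 G j, d_hi_ge0 G j).
rewrite filippov_loadE /load_min /load_max /onoff_load => -[[[? ?] ?] ?].
case: (ltgtP w (w_hi G j)) => ?; case: (ltgtP w (w_lo G j)) => ?; lra.
Qed.

Lemma filippov_load_bounded j w v :
  filippov_load G j w v -> d_lo G j <= v <= d_hi G j.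
Proof.
have := (w_lo_lt0 G j, w_hi_gt0 G j, d_lo_le0 G j, d_hi_ge0 G j).
rewrite filippov_loadE /load_min /load_max /onoff_load => -[[[? ?] ?] ?].
case: (ltgtP w (w_hi G j)) => ?; case: (ltgtP w (w_lo G j)) => ?; lra.
Qed.

Lemma filippov_load_homo j w w' v v' : w < w' ->
  filippov_load G j w v -> filippov_load G j w' v' -> v <= v'.
Proof.
have := (w_lo_lt0 G j, w_hi_gt0 G j, d_lo_le0 G j, d_hi_ge0 G j).
rewrite !filippov_loadE /load_min /load_max /onoff_load => -[[[? ?] ?] ?] ww'.
case: (ltgtP w (w_hi G j)) => ?; case: (ltgtP w (w_lo G j)) => ?;
case: (ltgtP w' (w_hi G j)) => ?; case: (ltgtP w' (w_lo G j)) => ?; lra.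
Qed.

Lemma filippov_load_monotone j w w' v v' :
  filippov_load G j w v -> filippov_load G j w' v' -> 0 <= (w - w') * (v - v').
Proof.
move=> Fv Fv'; have [ww|ww|->] := ltgtP w w'; last by rewrite subrr mul0r.
  by rewrite nmulr_rge0 ?subr_lt0// subr_le0; exact: filippov_load_homo ww Fv Fv'.
by rewrite mulr_ge0// subr_ge0 ?(ltW ww)//; exact: filippov_load_homo ww Fv' Fv.
Qed.

(* [onoff_load] is piecewise constant, so the Filippov map is upper
   semicontinuous with an actual inclusion rather than an approximate one. *)
Lemma filippov_load_near j w : exists2 d, 0 < d &
  forall w' v, `|w' - w| < d -> filippov_load G j w' v -> filippov_load G j w v.
Proof.
have [h1 h2 h3 h4] := And4 (w_lo_lt0 G j) (w_hi_gt0 G j) (d_lo_le0 G j) (d_hi_ge0 G j).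
pose m := Num.min (w_hi G j - w) (w - w_lo G j).
have m1 : m <= w_hi G j - w by rewrite ge_min lexx.
have m2 : m <= w - w_lo G j by rewrite ge_min lexx orbT.
(* [d] is the distance from [w] to the nearest threshold other than [w] itself. *)
pose d := if w > w_hi G j then w - w_hi G j
  else if w == w_hi G j then w_hi G j - w_lo G j
  else if w > w_lo G j then m
  else if w == w_lo G j then w_hi G j - w_lo G j else w_lo G j - w.
exists d => [|w' v].
  rewrite /d; case: (ltgtP w (w_hi G j)) => ?; case: (ltgtP w (w_lo G j)) => ?;
  by rewrite /m ?lt_min; lra.
rewrite ltr_distl /d; move: m m1 m2 {d} => m m1 m2.
rewrite !filippov_loadE /load_min /load_max /onoff_load.
case: (ltgtP w (w_hi G j)) => ?; case: (ltgtP w (w_lo G j)) => ?;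
case: (ltgtP w' (w_hi G j)) => ?; case: (ltgtP w' (w_lo G j)) => ? /andP[];
by lra.
Qed.

Lemma uniform_radius {I : finType} (P : I -> R -> Prop) :
  (forall i, exists2 d, 0 < d & forall e, e <= d -> P i e) ->
  exists2 d, 0 < d & forall i, P i d.
Proof.
move=> h; have [d dP] : {d : I -> R & forall i, 0 < d i /\ forall e, e <= d i -> P i e}.
  apply: (@choice _ _ (fun i d => 0 < d /\ forall e, e <= d -> P i e)) => i.
  by have [d ? ?] := h i; exists d.
exists (\big[Num.min/1]_i d i).
  by apply/bigmin_gtP; split => // i _; case: (dP i).
by move=> i; apply: (dP i).2; exact: bigmin_le_cond.
Qed.

(* The total load minus injection is strictly increasing in a common frequency
   up to its jumps; the synchronous frequency is where it crosses zero. *)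
Lemma synchronous_frequency : exists w (v : 'I_n -> R),
  (forall j, filippov_load G j w (v j)) /\
  \sum_j (pL G j + (alpha G j + A G j) * w + v j) = 0.
Proof.
(* Without buses the slope [C] used below would be 0, but then the sum is empty. *)
have [n0|n0] := posnP n.
  exists 0, (fun j => onoff_load G j 0); split; first by move=> j; exact: filippov_load_onoff.
  by rewrite big1// => j; have := ltn_ord j; rewrite [X in (_ < X)%N]n0.
pose C := \sum_j (alpha G j + A G j); pose p := \sum_j pL G j.
have sumE w (v : 'I_n -> R) :
    \sum_j (pL G j + (alpha G j + A G j) * w + v j) = p + C * w + \sum_j v j.
  by rewrite !big_split/= -mulr_suml.
have C0 : 0 < C.
  have pos j : 0 < alpha G j + A G j by rewrite addr_gt0 ?alpha_gt0 ?A_gt0.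
  rewrite /C (bigD1 (Ordinal n0))//= ltr_pwDl//.
  by apply: sumr_ge0 => j _; exact: ltW.
pose F w := p + C * w + \sum_j onoff_load G j w.
have Flo w : p + C * w + \sum_j d_lo G j <= F w.
  rewrite lerD2l ler_sum// => j _.
  by have /andP[] := filippov_load_bounded (filippov_load_onoff j w).
have Fhi w : F w <= p + C * w + \sum_j d_hi G j.
  rewrite lerD2l ler_sum// => j _.
  by have /andP[] := filippov_load_bounded (filippov_load_onoff j w).
pose S := [set w | F w <= 0].
have hS : has_sup S.
  split.
    exists (- (p + \sum_j d_hi G j) / C); rewrite /S /=; apply: le_trans (Fhi _) _.
    by rewrite mulrCA divff ?gt_eqF//; lra.
  exists (- (p + \sum_j d_lo G j) / C) => w /(le_trans (Flo w)) Fw.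
  by rewrite ler_pdivlMr//; lra.
pose w := sup S.
have [d d0 dP] : exists2 d, 0 < d & forall j w' v, `|w' - w| < d ->
    filippov_load G j w' v -> filippov_load G j w v.
  apply: (@uniform_radius 'I_n (fun j d => forall w' v, `|w' - w| < d ->
    filippov_load G j w' v -> filippov_load G j w v)) => j.
  have [d d0 dP] := filippov_load_near j w; exists d => // e ed w' v w'w.
  by apply: dP; exact: lt_le_trans w'w ed.
have Fnear w' : `|w' - w| < d ->
    p + C * w' + \sum_j load_min j w <= F w' <= p + C * w' + \sum_j load_max j w.
  move=> w'w; rewrite !lerD2l; apply/andP; split; apply: ler_sum => j _;
  by have /filippov_loadE/andP[] := dP _ _ _ w'w (filippov_load_onoff j w').
have small c : 0 < c -> exists2 e, 0 < e < d & C * e < c.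
  move=> c0; exists (Num.min (d / 2) (c / C / 2)).
    by rewrite lt_min gt_min !divr_gt0//= ltr_pdivrMr// ltr_pMr// ltr1n.
  rewrite mulrC -ltr_pdivlMr// gt_min; apply/orP; right.
  by rewrite ltr_pdivrMr// ltr_pMr ?ltr1n// divr_gt0.
(* Points of [S] accumulate at [w] from the left and none lie to its right: the former bound the
   total with minimal loads from above, the latter the total with maximal loads from below. *)
have minle : p + C * w + \sum_j load_min j w <= 0.
  rewrite leNgt; apply/negP => /small[e /andP[e0 ed] Ce].
  have [w' Sw' w'w] := sup_adherent e0 hS; rewrite -/w in w'w.
  have w'w2 : w' <= w by apply: ub_le_sup => //; case: hS.
  have /Fnear/andP[] : `|w' - w| < d by rewrite ltr_distl; lra.
  have : C * (w - e) <= C * w' by rewrite ler_wpM2l ?ltW.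
  by rewrite mulrBr; move: Sw'; rewrite /S /=; lra.
have maxge : 0 <= p + C * w + \sum_j load_max j w.
  rewrite leNgt; apply/negP => mlt.
  have /small[e /andP[e0 ed] Ce] : 0 < - (p + C * w + \sum_j load_max j w) by lra.
  have : w + e <= w.
    apply: ub_le_sup; first by case: hS.
    rewrite /S /=; have /Fnear/andP[_] : `|w + e - w| < d by rewrite ltr_distl; lra.
    by rewrite mulrDr; lra.
  by rewrite gerDl leNgt e0.
set a := \sum_j load_min j w in minle; set b := \sum_j load_max j w in maxge.
have ab : a <= b by apply: ler_sum => j _; exact: load_min_max.
(* One interpolation parameter, common to all buses, balances the total; each load stays in its
   interval by convexity. *)
have [t /andP[t0 t1] tE] : exists2 t, 0 <= t <= 1 & p + C * w + (a + t * (b - a)) = 0.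
  have [eab|neab] := eqVneq a b.
    by exists 0; [rewrite lexx ler01|rewrite mul0r addr0; move: minle maxge; rewrite eab; lra].
  have ba : 0 < b - a by rewrite subr_gt0 lt_neqAle neab.
  exists (- (p + C * w + a) / (b - a)); last by rewrite divfK ?gt_eqF//; lra.
  by rewrite divr_ge0 ?ler_pdivrMr//=; lra.
exists w, (fun j => load_min j w + t * (load_max j w - load_min j w)); split.
  move=> j; rewrite filippov_loadE; have := load_min_max j w.
  set x := load_min j w; set y := load_max j w => xy.
  have : 0 <= t * (y - x) by rewrite mulr_ge0// subr_ge0.
  have : 0 <= (1 - t) * (y - x) by rewrite mulr_ge0// subr_ge0.
  lra.
by rewrite sumE big_split/= -mulr_sumr sumrB.
Qed.

End OnOffLoad.

(** * Flows, equilibria and the Lyapunov function *)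

Section Network.
Context {R : realType} {n : nat} (G : power_network R n).
Implicit Types (e f : 'I_n * 'I_n -> R) (z u : 'I_n -> R) (x dx : state G).

Definition outflow f (j : 'I_n) : R :=
  \sum_(k in successors G j) f (j, k) - \sum_(i in predecessors G j) f (i, j).

(** Summation by parts: the divergence of a flow is adjoint to differences along lines. This makes
    the coupling between buses disappear from the derivative of [lyapunov]. *)
Lemma outflow_parts z f :
  \sum_j z j * outflow f j = \sum_(p in line G) f p * (z p.1 - z p.2).
Proof.
pose h (w : 'I_n * 'I_n -> R) := \sum_(p in line G) w p.
have hE w : h w = \sum_a \sum_(b | (a, b) \in line G) w (a, b).
  by rewrite /h pair_big_dep; apply: eq_big => -[a b].
transitivity (h (fun p => z p.1 * f p) - h (fun p => z p.2 * f p)); last first.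
  by rewrite -sumrB; apply: eq_bigr => p _; ring.
rewrite !hE [X in _ - X](exchange_big_dep xpredT)//= -sumrB.
apply: eq_bigr => j _; rewrite mulrBr !mulr_sumr.
by congr (_ - _); apply: eq_bigl => k; rewrite inE.
Qed.

(** Summation by parts against the indicator of [j]; as a single sum over lines, [outflow] is
    visibly linear in the flow. *)
Lemma outflowE f j :
  outflow f j = \sum_(p in line G) f p * ((p.1 == j)%:R - (p.2 == j)%:R).
Proof.
rewrite -(outflow_parts (fun i => (i == j)%:R)) (bigD1 j)//= eqxx mul1r.
by rewrite big1 ?addr0// => i /negbTE ->; rewrite mul0r.
Qed.

Lemma constant_on_lines z : (forall i j, (i, j) \in line G -> z i = z j) ->
  forall i j, z i = z j.
Proof.
move=> zl i j; have /connectP[p + ->] := line_connected G i j.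
elim: p i => //= k p ih i /andP[/orP[] /zl ik /ih <-] //.
Qed.

(* The cokernel of the incidence matrix of a connected graph consists of the
   constant vectors, so the flows realize exactly the balanced injections. *)
Lemma flow_exists u : \sum_j u j = 0 -> exists f, forall j, outflow f j = u j.
Proof.
move=> u0; pose D := \matrix_(l < #|line G|, j < n)
  (((enum_val l).1 == j)%:R - ((enum_val l).2 == j)%:R : R).
have : ((\row_j u j) <= D)%MS.
  rewrite submxE; apply/eqP/rowP => c; rewrite mxE [RHS]mxE.
  pose z i := cokermx D i c.
  have zl i j : (i, j) \in line G -> z i = z j.
    move=> ij; have : (D *m cokermx D) (enum_rank_in ij (i, j)) c = 0.
      by rewrite mulmx_coker mxE.
    rewrite mxE; under eq_bigr => k _ do rewrite mxE enum_rankK_in// mulrBl.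
    rewrite sumrB (bigD1 i)//= eqxx mul1r big1 => [|k /negbTE]; last first.
      by rewrite eq_sym => ->; rewrite mul0r.
    rewrite (bigD1 j)//= eqxx mul1r big1 => [|k /negbTE]; last first.
      by rewrite eq_sym => ->; rewrite mul0r.
    by rewrite !addr0 => /subr0_eq.
  have [n0|n0] := posnP n.
    by rewrite big1// => j _; have := ltn_ord j; rewrite [X in (_ < X)%N]n0.
  under eq_bigr => j _ do
    rewrite mxE -/(z j) (constant_on_lines zl j (Ordinal n0)).
  by rewrite -mulr_suml u0 mul0r.
move=> /submxP[w uE].
exists (fun p => \sum_(l | enum_val l == p) w 0 l) => j.
have := congr1 (fun r : 'rV_n => r 0 j) uE; rewrite !mxE => ->.
rewrite outflowE big_enum_val/=.
apply: eq_bigr => l _; rewrite mxE; congr (_ * _).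
by rewrite (bigD1 l)//= big1 ?addr0// => k /andP[/eqP/enum_val_inj ->]; rewrite eqxx.
Qed.

(** [power] with the line given as a pair, the form that [outflow] expects. *)
Definition flow x (p : 'I_n * 'I_n) : R := B G p.1 p.2 * eta x p.1 p.2.

Lemma at_line_enum_val (v : 'rV[R]_#|line G|) l :
  at_line v (enum_val l).1 (enum_val l).2 = v 0 l.
Proof.
rewrite /at_line -surjective_pairing (bigD1 l)//= big1 ?addr0// => k.
by move=> /andP[/eqP/enum_val_inj ->]; rewrite eqxx.
Qed.

Definition mk_state e z u : state G :=
  (\row_l e (enum_val l), \row_j z j, \row_j u j).

Lemma eta_mk_state e z u i j : (i, j) \in line G -> eta (mk_state e z u) i j = e (i, j).
Proof.
move=> ij; have := at_line_enum_val (\row_l e (enum_val l)) (enum_rank_in ij (i, j)).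
by rewrite mxE enum_rankK_in.
Qed.

Lemma omega_mk_state e z u j : omega (mk_state e z u) j = z j.
Proof. by rewrite /omega mxE. Qed.

Lemma pM_mk_state e z u j : pM (mk_state e z u) j = u j.
Proof. by rewrite /pM mxE. Qed.

Lemma at_lineB (v w : 'rV[R]_#|line G|) i j :
  at_line (v - w) i j = at_line v i j - at_line w i j.
Proof. by rewrite /at_line -sumrB; apply: eq_bigr => l _; rewrite !mxE. Qed.

Lemma Q_omega x dx j : Q x dx -> exists2 v, filippov_load G j (omega x j) v &
  omega dx j = (M G j)^-1 *
    (- pL G j + pM x j - A G j * omega x j - v - outflow (flow x) j).
Proof.
move=> [_ h _]; have [v Fv ->] := h j; exists v => //; congr (_ * _).
by rewrite /outflow opprB addrA; exact: addrAC.
Qed.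

Lemma equilibriumP x : equilibrium x <->
  [/\ forall i j, (i, j) \in line G -> omega x i = omega x j,
      forall j, exists2 v, filippov_load G j (omega x j) v &
        - pL G j + pM x j - A G j * omega x j - v - outflow (flow x) j = 0
    & forall j, pM x j + alpha G j * omega x j = 0].
Proof.
have eta0 i j : eta (0 : state G) i j = 0.
  by rewrite /eta /at_line big1// => l _; rewrite mxE.
have omega0 j : omega (0 : state G) j = 0 by rewrite /omega mxE.
have pM0 j : pM (0 : state G) j = 0 by rewrite /pM mxE.
split=> [xeq|[h1 h2 h3]].
  have [h1 _ h3] := xeq; split.
  - by move=> i j /h1; rewrite eta0 => /esym/subr0_eq.
  - move=> j; have [v Fv /esym/eqP] := Q_omega j xeq.
    by rewrite omega0 mulf_eq0 invr_eq0 gt_eqF ?M_gt0//= => /eqP E; exists v.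
  - move=> j; have /esym/eqP := h3 j.
    by rewrite pM0 mulf_eq0 oppr_eq0 invr_eq0 gt_eqF ?tau_gt0//= => /eqP.
split.
- by move=> i j /h1 ->; rewrite eta0 subrr.
- move=> j; have [v Fv E] := h2 j; exists v => //.
  rewrite omega0 -[LHS](mulr0 (M G j)^-1); congr (_ * _).
  by rewrite -[LHS]E /outflow opprB addrA; exact: addrAC.
- by move=> j; rewrite pM0 h3 mulr0.
Qed.

(** At the synchronous frequency, with [pM] settled accordingly, the power left over at the buses
    sums to zero, so some flow carries it; dividing by [B] recovers [eta]. *)
Lemma equilibrium_exists : exists x, equilibrium x.
Proof.
have [w [v [Fv s0]]] := synchronous_frequency G.
have [f fE] := @flow_exists (fun j => - (pL G j + (alpha G j + A G j) * w + v j))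
  ltac:(by rewrite sumrN s0 oppr0).
exists (mk_state (fun p => (B G p.1 p.2)^-1 * f p) (fun=> w) (fun j => - alpha G j * w)).
apply/equilibriumP; split=> [i j _|j|j]; rewrite ?omega_mk_state ?pM_mk_state//; last by ring.
exists (v j) => //; rewrite outflowE.
rewrite (eq_bigr (fun p => f p * ((p.1 == j)%:R - (p.2 == j)%:R))).
  by rewrite -outflowE fE; ring.
move=> [a b] ab; congr (_ * _); rewrite /flow eta_mk_state//= mulrA.
by rewrite divff ?mul1r// gt_eqF// B_gt0.
Qed.

(** The weights make the cross terms cancel: [tau / alpha] removes the products of [omega] and [pM]
    deviations, and [B] matches the flow terms with the power exchanged between buses. *)
Definition lyapunov (xs x : state G) : R :=
  \sum_j (M G j * (omega x j - omega xs j) ^+ 2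
          + tau G j / alpha G j * (pM x j - pM xs j) ^+ 2)
  + \sum_(p in line G) B G p.1 p.2 * (eta x p.1 p.2 - eta xs p.1 p.2) ^+ 2.

Definition dissipation (xs x : state G) : R :=
  \sum_j (A G j * (omega x j - omega xs j) ^+ 2
          + (alpha G j)^-1 * (pM x j - pM xs j) ^+ 2).

(* The derivative of [lyapunov] along a velocity [dx]; monotonicity of the load
   maps makes the load contribution nonpositive. *)
Lemma lyapunov_decrease xs x dx : equilibrium xs -> Q x dx ->
  \sum_j (M G j * ((omega x j - omega xs j) * omega dx j *+ 2)
          + tau G j / alpha G j * ((pM x j - pM xs j) * pM dx j *+ 2))
  + \sum_(p in line G)
      B G p.1 p.2 * ((eta x p.1 p.2 - eta xs p.1 p.2) * eta dx p.1 p.2 *+ 2)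
  <= - (dissipation xs x *+ 2).
Proof.
move=> /equilibriumP[sync bal pbal] Qx; have [deta _ dp] := Qx.
set z := fun j => omega x j - omega xs j.
pose g p := flow x p - flow xs p.
have -> : \sum_(p in line G)
    B G p.1 p.2 * ((eta x p.1 p.2 - eta xs p.1 p.2) * eta dx p.1 p.2 *+ 2) =
    (\sum_j z j * outflow g j) *+ 2.
  (* At [xs] the two ends of a line have equal frequencies, so the velocity of [eta] is a difference
     of deviations [z]. *)
  rewrite outflow_parts -sumrMnl; apply: eq_bigr => -[a b] ab /=.
  rewrite deta// /g /flow/= /z (sync a b)//; ring.
have gE j : outflow g j = outflow (flow x) j - outflow (flow xs) j.
  by rewrite !outflowE -sumrB; apply: eq_bigr => p _; rewrite mulrBl.
rewrite -sumrMnl -big_split/= -sumrMnl -sumrN; apply: ler_sum => j _.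
have [v Fv ->] := Q_omega j Qx; have [v' Fv' E] := bal j.
have mono := filippov_load_monotone Fv Fv'.
rewrite gE dp; have := pbal j.
have : outflow (flow xs) j = - pL G j + pM xs j - A G j * omega xs j - v' by lra.
rewrite /z; set o := outflow _ _; move: (outflow _ _) => o' -> pE.
have M0 : M G j != 0 by rewrite gt_eqF ?M_gt0.
have t0 : tau G j != 0 by rewrite gt_eqF ?tau_gt0.
have a0 : alpha G j != 0 by rewrite gt_eqF ?alpha_gt0.
have pE' : pM xs j = - (alpha G j * omega xs j) by lra.
(* After all cancellations the two sides differ, bus by bus, by twice the monotonicity term of the
   load. *)
rewrite -subr_ge0 [X in 0 <= X](_ : _ =
  ((omega x j - omega xs j) * (v - v')) *+ 2) ?mulrn_wge0//.
by rewrite pE'; field; rewrite ?M0 ?t0 ?a0.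
Qed.

End Network.

(** * Barbalat's lemma and forward bounds *)

Lemma is_derive_sumr {R : realType} {V W : normedModType R} {I : Type} (r : seq I)
    (P : pred I) (F : I -> V -> W) (x v : V) (D : I -> W) :
  (forall i, P i -> is_derive x v (F i) (D i)) ->
  is_derive x v (fun y => \sum_(i <- r | P i) F i y) (\sum_(i <- r | P i) D i).
Proof.
move=> FD; elim: r => [|i r ih].
  rewrite big_nil (_ : (fun _ => _) = cst 0); first exact: is_derive_cst.
  by apply/funext => y; rewrite big_nil.
rewrite big_cons (_ : (fun _ => _) =
  fun y => if P i then F i y + \sum_(j <- r | P j) F j y else \sum_(j <- r | P j) F j y).
  by case: ifP => // Pi; apply: (is_deriveD (FD _ Pi) ih).
by apply/funext => y; rewrite big_cons.
Qed.

Lemma is_derive_weighted_sqr {R : realType} {f : R -> R} {t D : R} (k c : R) :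
  is_derive t 1 f D ->
  is_derive t 1 (fun s => k * (f s - c) ^+ 2) (k * ((f t - c) * D *+ 2)).
Proof.
move=> fD; have gD : is_derive t 1 (fun s => f s - c) D.
  by have := is_deriveB fD (is_derive_cst c t 1); rewrite subr0.
pose g s := f s - c; have hD := is_deriveZ k (is_deriveM gD gD).
rewrite (_ : (fun s => _) = k *: (g * g)); last first.
  by apply/funext => s; rewrite expr2.
by apply: (is_derive_eq hD); rewrite /GRing.scale/=; ring.
Qed.

Lemma ac_weighted_sqr {R : realType} {a b : R} {f : R -> R} (k c : R) :
  absolutely_continuous a b f ->
  absolutely_continuous a b (fun s => k * (f s - c) ^+ 2).
Proof.
by move=> acf; apply: acM; [exact: ac_cst|apply: acM; apply: acD => //; exact: ac_cst].
Qed.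

Definition bounded_forward {R : realType} (f : R -> R) :=
  exists K, forall t, 0 <= t -> `|f t| <= K.

Lemma bounded_forward_cst {R : realType} (c : R) : bounded_forward (fun=> c).
Proof. by exists `|c|. Qed.

Lemma bounded_forwardD {R : realType} (f g : R -> R) :
  bounded_forward f -> bounded_forward g -> bounded_forward (fun t => f t + g t).
Proof.
move=> [K fK] [K' gK]; exists (K + K') => t t0.
by rewrite (le_trans (ler_normD _ _))// lerD ?fK ?gK.
Qed.

Lemma bounded_forwardM {R : realType} (f g : R -> R) :
  bounded_forward f -> bounded_forward g -> bounded_forward (fun t => f t * g t).
Proof.
move=> [K fK] [K' gK]; exists (K * K') => t t0.
by rewrite normrM ler_pM ?fK ?gK.
Qed.

Lemma bounded_forward_sum {R : realType} (I : Type) (r : seq I) (P : pred I)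
    (F : I -> R -> R) :
  (forall i, P i -> bounded_forward (F i)) ->
  bounded_forward (fun t => \sum_(i <- r | P i) F i t).
Proof.
move=> bF; elim: r => [|i r [K ih]].
  by exists 0 => t _; rewrite big_nil normr0.
have [Pi|Pi] := boolP (P i); last by exists K => t; rewrite big_cons (negbTE Pi); exact: ih.
have [K' iK'] := bF _ Pi; exists (K' + K) => t t0; rewrite big_cons Pi.
by rewrite (le_trans (ler_normD _ _))// lerD ?iK' ?ih.
Qed.

(** Integral-free form. If [f] has size at least [e] at time [t], the Lipschitz bound keeps it above
    [e / 2] for a time [h], and [V] must drop by a fixed amount; this is impossible once [V] is that
    close to its infimum. *)
Lemma barbalat {R : realType} (V f : R -> R) (kappa L : R) :
  (forall t, 0 <= t -> 0 <= V t) -> 0 < kappa ->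
  (forall s t c, 0 <= s -> s <= t -> 0 <= c ->
     (forall r, s <= r <= t -> c <= f r ^+ 2) ->
     V t <= V s - kappa * c * (t - s)) ->
  (forall s t, 0 <= s -> s <= t -> `|f t - f s| <= L * (t - s)) ->
  f t @[t --> +oo] --> 0.
Proof.
move=> V0 k0 dV fL; apply/cvgr0Pnorm_lt => e e0.
pose L' := `|L| + 1; have L'0 : 0 < L' by rewrite ltr_wpDl.
pose h := e / 2 / L'; have h0 : 0 < h by rewrite !divr_gt0.
have c0 : 0 < (e / 2) ^+ 2 by rewrite exprn_gt0// divr_gt0.
pose S := [set V t | t in [set t | 0 <= t]].
have lbS : has_lbound S by exists 0 => _ [t /= t0 <-]; exact: V0.
have hS : has_inf S by split => //; exists (V 0), 0 => //=; exact: lexx.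
have d0 : 0 < kappa * (e / 2) ^+ 2 * h by apply: mulr_gt0 => //; exact: mulr_gt0.
have [_ [T /= T0 <-] VT] := inf_adherent d0 hS.
near=> t.
have Tt : T <= t by near: t; apply: nbhs_pinfty_ge; rewrite num_real.
have t0 : 0 <= t := le_trans T0 Tt.
rewrite ltNge; apply/negP => eft.
have VtT : V t <= V T.
  have := dV T t 0 T0 Tt (lexx 0) (fun r _ => sqr_ge0 (f r)).
  by rewrite mulr0 mul0r subr0.
have : V (t + h) <= V t - kappa * (e / 2) ^+ 2 * (t + h - t).
  apply: dV => //; [lra|exact: ltW|move=> r /andP[tr rh]].
  rewrite -[X in _ <= X]real_normK ?num_real// ler_sqr ?nnegrE//; last lra.
  have : `|f r - f t| <= e / 2.
    apply: le_trans (fL _ _ t0 tr) _.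
    apply: (@le_trans _ _ (L' * h)); last by rewrite mulrC divfK// gt_eqF.
    apply: (@le_trans _ _ (L' * (r - t))); last by apply: ler_wpM2l; [exact: ltW|lra].
    by apply: ler_wpM2r; have := ler_norm L; rewrite /L'; lra.
  by have := lerB_dist (f t) (f t - f r); rewrite subKr distrC; lra.
have : inf S <= V (t + h) by apply: ge_inf => //; exists (t + h) => //=; lra.
have -> : t + h - t = h by lra.
lra.
Unshelve. all: by end_near.
Qed.

Lemma row_norm_coord {R : realType} {m : nat} (v : 'rV[R]_m) l : `|v 0 l| <= `|v|.
Proof.
by rewrite [leRHS]/Num.Def.normr/= mx_normrE; apply/bigmax_geP; right; exists (0, l).
Qed.

Lemma row_norm_le {R : realType} {m : nat} (v : 'rV[R]_m) (K : R) :
  0 <= K -> (forall l, `|v 0 l| <= K) -> `|v| <= K.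
Proof.
move=> K0 vK; rewrite [leLHS]/Num.Def.normr/= mx_normrE; apply/bigmax_leP; split=> //.
by move=> [i l] _ /=; rewrite (ord1 i).
Qed.

(** * Solutions *)

Section Coordinates.
Context {R : realType} {n : nat} {G : power_network R n}.
Implicit Types (x y : state G) (i j : 'I_n).

Lemma omegaB x y j : omega (x - y) j = omega x j - omega y j.
Proof. by rewrite /omega !mxE. Qed.

Lemma pMB x y j : pM (x - y) j = pM x j - pM y j.
Proof. by rewrite /pM !mxE. Qed.

Lemma etaB x y i j : eta (x - y) i j = eta x i j - eta y i j.
Proof. exact: at_lineB. Qed.

Lemma omegaZ (c : R) x j : omega (c *: x) j = c * omega x j.
Proof. by rewrite /omega !mxE. Qed.

Lemma pMZ (c : R) x j : pM (c *: x) j = c * pM x j.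
Proof. by rewrite /pM !mxE. Qed.

Lemma etaZ (c : R) x i j : eta (c *: x) i j = c * eta x i j.
Proof. by rewrite /eta /at_line mulr_sumr; apply: eq_bigr => l _; rewrite !mxE. Qed.

Lemma omega_norm x j : `|omega x j| <= 1 * `|x|.
Proof.
by rewrite mul1r (le_trans (row_norm_coord _ _))// !prod_normE !le_max lexx orbT.
Qed.

Lemma pM_norm x j : `|pM x j| <= 1 * `|x|.
Proof.
by rewrite mul1r (le_trans (row_norm_coord _ _))// !prod_normE !le_max lexx orbT.
Qed.

Lemma eta_norm x i j : `|eta x i j| <= #|line G|%:R * `|x|.
Proof.
rewrite /eta /at_line (le_trans (ler_norm_sum _ _ _))//.
apply: (@le_trans _ _ (\sum_(l < #|line G|) `|x|)).
  rewrite big_mkcond; apply: ler_sum => l _; case: ifP => // _.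
  by rewrite (le_trans (row_norm_coord _ _))// !prod_normE !le_max lexx.
by rewrite sumr_const card_ord mulr_natl.
Qed.

Lemma state_norm_le x (K : R) : 0 <= K ->
  (forall i j, (i, j) \in line G -> `|eta x i j| <= K) ->
  (forall j, `|omega x j| <= K) -> (forall j, `|pM x j| <= K) -> `|x| <= K.
Proof.
move=> K0 he hw hp; rewrite !prod_normE !ge_max -andbA; apply/and3P.
split; apply: row_norm_le => // l.
rewrite -at_line_enum_val; apply: he.
by rewrite -surjective_pairing enum_valP.
Qed.

End Coordinates.

Section Solution.
Context {R : realType} {n : nat} {G : power_network R n}.
Variables (x : R -> state G) (solx : filippov_solution x).
Implicit Types (i j : 'I_n) (s t T : R).

Lemma solution_ac T : absolutely_continuous 0 T x.
Proof.
have T1 : 0 < `|T| + 1 by rewrite ltr_wpDl.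
have [acx _] := solx T1; apply: ac_subitv acx => //.
by rewrite (le_trans (ler_norm _))// lerDl.
Qed.

Lemma omega_ac T j : absolutely_continuous 0 T (fun t => omega (x t) j).
Proof.
exact: (ac_bounded_linear (phi := fun y => omega y j) (fun a b => omegaB a b j)
  (fun a => omega_norm a j) (solution_ac T)).
Qed.

Lemma pM_ac T j : absolutely_continuous 0 T (fun t => pM (x t) j).
Proof.
exact: (ac_bounded_linear (phi := fun y => pM y j) (fun a b => pMB a b j)
  (fun a => pM_norm a j) (solution_ac T)).
Qed.

Lemma eta_ac T i j : absolutely_continuous 0 T (fun t => eta (x t) i j).
Proof.
exact: (ac_bounded_linear (phi := fun y => eta y i j) (fun a b => etaB a b i j)
  (fun a => eta_norm a i j) (solution_ac T)).
Qed.

Definition velocity t (dx : state G) :=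
  [/\ Q (x t) dx,
      forall j, is_derive t 1 (fun s => omega (x s) j) (omega dx j),
      forall j, is_derive t 1 (fun s => pM (x s) j) (pM dx j)
    & forall i j, is_derive t 1 (fun s => eta (x s) i j) (eta dx i j)].

Lemma solution_velocity s t : 0 <= s ->
  {ae lebesgue_measure, forall r, s <= r <= t -> exists dx, velocity r dx}.
Proof.
move=> s0; have T1 : 0 < `|t| + 1 by rewrite ltr_wpDl.
have [_] := solx T1.
apply: (@filterS _ _ (ae_filter_ringOfSetsType lebesgue_measure)).
move=> r h /andP[sr rt].
have [|xr Qr] := h.
  by rewrite (le_trans s0 sr)/= (le_trans rt)// (le_trans (ler_norm _))// lerDl.
exists ('D_1 x r); have xD := DeriveDef xr erefl; split => //.
- move=> j; exact: (is_derive_bounded_linear (phi := fun y => omega y j)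
    (fun a b => omegaB a b j) (fun c a => omegaZ c a j) (fun a => omega_norm a j) xD).
- move=> j; exact: (is_derive_bounded_linear (phi := fun y => pM y j)
    (fun a b => pMB a b j) (fun c a => pMZ c a j) (fun a => pM_norm a j) xD).
- move=> i j; exact: (is_derive_bounded_linear (phi := fun y => eta y i j)
    (fun a b => etaB a b i j) (fun c a => etaZ c a i j) (fun a => eta_norm a i j) xD).
Qed.

(** Every later use of the differential inclusion passes through this lemma: a bound valid for all
    velocities integrates, and the null set of bad times is no longer visible. *)
Lemma increment_le {f : R -> R} {s t} (c : R) : 0 <= s -> s <= t ->
  absolutely_continuous 0 t f ->
  (forall r dx, s <= r <= t -> velocity r dx -> exists2 D, is_derive r 1 f D & D <= c) ->
  f t - f s <= c * (t - s).
Proof.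
move=> s0 st acf fD; apply: ac_increment_le => //; first exact: ac_subitv acf.
apply: (@filterS _ _ (ae_filter_ringOfSetsType lebesgue_measure))
  (solution_velocity t s0) => r h sr.
by have [dx vdx] := h sr; exact: fD sr vdx.
Qed.

Lemma increment_norm_le {f : R -> R} {s t} (c : R) : 0 <= s -> s <= t ->
  absolutely_continuous 0 t f ->
  (forall r dx, s <= r <= t -> velocity r dx -> exists2 D, is_derive r 1 f D & `|D| <= c) ->
  `|f t - f s| <= c * (t - s).
Proof.
move=> s0 st acf fD; rewrite ler_norml; apply/andP; split.
  have := @increment_le (fun r => - f r) s t c s0 st (acN acf).
  move=> /(_ _)/wrap[r dx sr /(fD _ _ sr)[D fDr Dc]|]; last by lra.
  exists (- D); first exact: (is_deriveN fDr).
  by rewrite (le_trans _ Dc)// -normrN ler_norm.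
apply: increment_le => // r dx sr /(fD _ _ sr)[D fDr Dc]; exists D => //.
by rewrite (le_trans _ Dc)// ler_norm.
Qed.

Lemma lyapunov_ge0 (xs y : state G) : 0 <= lyapunov xs y.
Proof.
apply: addr_ge0; apply: sumr_ge0 => p hp.
  by rewrite addr_ge0// mulr_ge0 ?sqr_ge0// ?divr_ge0// ltW ?M_gt0 ?tau_gt0 ?alpha_gt0.
by rewrite mulr_ge0 ?sqr_ge0// ltW// B_gt0// -surjective_pairing.
Qed.

(** A constant lower bound on the dissipation replaces its integral: this is the shape that
    [barbalat] asks for, and [c = 0] gives monotonicity. *)
Lemma lyapunov_increment (xs : state G) s t (c : R) : equilibrium xs ->
  0 <= s -> s <= t -> (forall r, s <= r <= t -> c <= dissipation xs (x r)) ->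
  lyapunov xs (x t) <= lyapunov xs (x s) - c *+ 2 * (t - s).
Proof.
move=> eqs s0 st cD.
suff : lyapunov xs (x t) - lyapunov xs (x s) <= - (c *+ 2) * (t - s) by lra.
apply: (@increment_le (fun r => lyapunov xs (x r))) => //.
  apply: acD; apply: ac_sum => k; [apply: acD|]; apply: ac_weighted_sqr;
  [exact: omega_ac|exact: pM_ac|exact: eta_ac].
move=> r dx sr [Qr dw dp de]; eexists; last first.
  apply: le_trans (lyapunov_decrease eqs Qr) _.
  by rewrite lerN2 lerMn2r cD.
apply: is_deriveD; apply: is_derive_sumr => p _; last exact: is_derive_weighted_sqr.
by apply: is_deriveD; exact: is_derive_weighted_sqr.
Qed.

Lemma lyapunov_nonincreasing (xs : state G) s t : equilibrium xs ->
  0 <= s -> s <= t -> lyapunov xs (x t) <= lyapunov xs (x s).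
Proof.
move=> eqs s0 st; have := @lyapunov_increment xs s t 0 eqs s0 st.
rewrite mul0rn mul0r subr0; apply=> r _; apply: sumr_ge0 => j _.
by apply: addr_ge0; apply: mulr_ge0;
  rewrite ?sqr_ge0 ?invr_ge0// ltW// ?A_gt0 ?alpha_gt0.
Qed.

Lemma lyapunov_coord (xs y : state G) :
  [/\ forall j, M G j * (omega y j - omega xs j) ^+ 2 <= lyapunov xs y,
      forall j, tau G j / alpha G j * (pM y j - pM xs j) ^+ 2 <= lyapunov xs y
    & forall i j, (i, j) \in line G ->
        B G i j * (eta y i j - eta xs i j) ^+ 2 <= lyapunov xs y].
Proof.
pose a j := M G j * (omega y j - omega xs j) ^+ 2.
pose b j := tau G j / alpha G j * (pM y j - pM xs j) ^+ 2.
pose c p := B G p.1 p.2 * (eta y p.1 p.2 - eta xs p.1 p.2) ^+ 2.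
have a0 j : 0 <= a j by rewrite mulr_ge0 ?sqr_ge0// ltW ?M_gt0.
have b0 j : 0 <= b j.
  by rewrite mulr_ge0 ?sqr_ge0// divr_ge0// ltW ?tau_gt0 ?alpha_gt0.
have c0 p : p \in line G -> 0 <= c p.
  by move=> hp; rewrite mulr_ge0 ?sqr_ge0// ltW// B_gt0// -surjective_pairing.
have c1 : 0 <= \sum_(p in line G) c p by exact: sumr_ge0.
have ab j : a j + b j <= lyapunov xs y.
  rewrite /lyapunov (bigD1 j)//= -!addrA lerD2l lerDl addr_ge0//.
  by apply: sumr_ge0 => i _; exact: addr_ge0 (a0 i) (b0 i).
split.
- by move=> j; apply: le_trans (ab j); rewrite lerDl.
- by move=> j; apply: le_trans (ab j); rewrite lerDr.
- move=> i j ij; rewrite /lyapunov (bigD1 (i, j) ij)/= addrCA lerDl.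
  rewrite addr_ge0//; first by apply: sumr_ge0 => k _; exact: addr_ge0 (a0 k) (b0 k).
  by apply: sumr_ge0 => p /andP[hp _]; exact: c0.
Qed.

End Solution.

(** * Boundedness, cluster points and the limits of frequencies and mechanical powers *)

Lemma norm_le_weighted_sqr {R : realType} (a C y : R) :
  0 < a -> a * y ^+ 2 <= C -> `|y| <= 1 + C / a.
Proof.
move=> a0; rewrite mulrC -ler_pdivlMr// -real_normK ?num_real// => yC.
(* This square bounds [|y|] by [y ^+ 2 + 1/4], which avoids square roots. *)
by have := sqr_ge0 (`|y| - 1 / 2); rewrite sqrrB; lra.
Qed.

Lemma bounded_forward_weighted_sqr {R : realType} (f : R -> R) (a c C : R) : 0 < a ->
  (forall t, 0 <= t -> a * (f t - c) ^+ 2 <= C) -> bounded_forward f.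
Proof.
move=> a0 h; exists (1 + C / a + `|c|) => t t0.
have := norm_le_weighted_sqr a0 (h t t0).
by have := ler_normD (f t - c) c; rewrite subrK; lra.
Qed.

(** A cluster point of the filter [f @ +oo] in a compact box is approached by every tail of [f],
    hence at arbitrarily late times. *)
Lemma bounded_row_cluster {R : realType} {m : nat} (f : R -> 'rV[R]_m) (K : R) :
  (forall t, 0 <= t -> `|f t| <= K) ->
  exists l, forall e T, 0 < e -> exists2 t, T <= t & `|l - f t| < e.
Proof.
move=> fK; pose A := [set v : 'rV[R]_m | forall l, v ord0 l \in `[- K, K]].
have cA : compact A.
  by apply: (@rV_compact _ _ (fun=> `[- K, K]%classic)) => _; exact: segment_compact.
have AF : \forall t \near +oo, A (f t).
  near=> t => l; rewrite in_itv/= -ler_norml (le_trans (row_norm_coord _ _))//.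
  by apply: fK; near: t; apply: nbhs_pinfty_ge; rewrite num_real.
have [l [_ ll]] := cA (f @ +oo) _ AF.
exists l => e T e0.
have TF : \forall t \near +oo, [set f s | s in [set s | T <= s]] (f t).
  have : \forall t \near +oo, T <= t by apply: nbhs_pinfty_ge; rewrite num_real.
  by apply: filterS => t Tt; exists t.
have [_ [[t /= Tt <-] lt]] := ll _ _ TF (nbhsx_ballx l e e0).
by exists t => //; rewrite -ball_normE in lt.
Unshelve. all: by end_near.
Qed.

Section Convergence.
Context {R : realType} {n : nat} {G : power_network R n}.
Implicit Types (y z xs : state G) (i j : 'I_n).

(** The load that would balance bus [j]: the frequency velocity is [net_power] minus the actual
    load, divided by the inertia [M]. *)
Definition net_power y j : R :=
  - pL G j + pM y j - A G j * omega y j - outflow G (flow y) j.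

Lemma net_power_dist j : exists2 K, 0 < K & forall y z (e : R),
  `|omega y j - omega z j| <= e -> `|pM y j - pM z j| <= e ->
  (forall a b, (a, b) \in line G -> `|eta y a b - eta z a b| <= e) ->
  `|net_power y j - net_power z j| <= K * e.
Proof.
have B0 p : p \in line G -> 0 <= B G p.1 p.2.
  by move=> hp; rewrite ltW// B_gt0// -surjective_pairing.
exists (1 + A G j + \sum_(p in line G) B G p.1 p.2).
  by rewrite ltr_pwDl ?addr_gt0 ?A_gt0//; exact: sumr_ge0.
move=> y z e we pe ee; have e0 : 0 <= e by exact: le_trans we.
have -> : net_power y j - net_power z j = (pM y j - pM z j)
    - A G j * (omega y j - omega z j)
    - (outflow G (flow y) j - outflow G (flow z) j) by rewrite /net_power; ring.
have h1 : `|A G j * (omega y j - omega z j)| <= A G j * e.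
  by rewrite normrM gtr0_norm ?A_gt0// ler_wpM2l// ltW// A_gt0.
have h2 : `|outflow G (flow y) j - outflow G (flow z) j| <=
    (\sum_(p in line G) B G p.1 p.2) * e.
  rewrite !outflowE -sumrB mulr_suml; apply: le_trans (ler_norm_sum _ _ _) _.
  apply: ler_sum => p hp; rewrite -mulrBl /flow -mulrBr !normrM ger0_norm ?B0//.
  rewrite -mulrA ler_wpM2l ?B0// -[leRHS]mulr1 ler_pM//.
    by apply: ee; rewrite -surjective_pairing.
  by case: eqP; case: eqP => _ _; rewrite ?subrr ?subr0 ?sub0r ?normrN ?normr1 ?normr0.
have := ler_normB (pM y j - pM z j) (A G j * (omega y j - omega z j)).
have := ler_normB (pM y j - pM z j - A G j * (omega y j - omega z j))
  (outflow G (flow y) j - outflow G (flow z) j).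
by rewrite !mulrDl mul1r; lra.
Qed.

Lemma lyapunov_small xs : exists2 K, 0 < K & forall y (e : R),
  (forall j, `|omega y j - omega xs j| <= e) ->
  (forall j, `|pM y j - pM xs j| <= e) ->
  (forall i j, (i, j) \in line G -> `|eta y i j - eta xs i j| <= e) ->
  lyapunov xs y <= K * e ^+ 2.
Proof.
pose K := \sum_j (M G j + tau G j / alpha G j) + \sum_(p in line G) B G p.1 p.2.
have B0 p : p \in line G -> 0 <= B G p.1 p.2.
  by move=> hp; rewrite ltW// B_gt0// -surjective_pairing.
have T0 j : 0 <= tau G j / alpha G j by rewrite divr_ge0// ltW ?tau_gt0 ?alpha_gt0.
have M0 j : 0 <= M G j by rewrite ltW ?M_gt0.
have K0 : 0 <= K.
  by apply: addr_ge0; apply: sumr_ge0 => // j _; exact: addr_ge0.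
exists (K + 1) => [|y e we pe ee]; first by rewrite ltr_wpDl.
have sq (u : R) : `|u| <= e -> u ^+ 2 <= e ^+ 2.
  by move=> ue; rewrite -real_normK ?num_real// lerXn2r// nnegrE (le_trans _ ue).
apply: (@le_trans _ _ (K * e ^+ 2)); last first.
  by rewrite ler_wpM2r ?sqr_ge0// lerDl.
rewrite mulrDl !mulr_suml; apply: lerD; apply: ler_sum => p hp.
  by rewrite mulrDl; apply: lerD; apply: ler_wpM2l => //; exact: sq.
by apply: ler_wpM2l; [exact: B0|apply/sq/ee; rewrite -surjective_pairing].
Qed.

Lemma dissipation_coord xs y :
  (forall j, A G j * (omega y j - omega xs j) ^+ 2 <= dissipation xs y) /\
  (forall j, (alpha G j)^-1 * (pM y j - pM xs j) ^+ 2 <= dissipation xs y).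
Proof.
pose a j := A G j * (omega y j - omega xs j) ^+ 2.
pose b j := (alpha G j)^-1 * (pM y j - pM xs j) ^+ 2.
have a0 j : 0 <= a j by rewrite mulr_ge0 ?sqr_ge0// ltW ?A_gt0.
have b0 j : 0 <= b j by rewrite mulr_ge0 ?sqr_ge0// invr_ge0 ltW ?alpha_gt0.
have ab j : a j + b j <= dissipation xs y.
  rewrite /dissipation (bigD1 j)//= lerDl.
  by apply: sumr_ge0 => i _; exact: addr_ge0 (a0 i) (b0 i).
by split=> j; apply: le_trans (ab j); rewrite ?lerDl ?lerDr.
Qed.

Variables (x : R -> state G) (solx : filippov_solution x).

Lemma solution_bounded :
  [/\ forall j, bounded_forward (fun t => omega (x t) j),
      forall j, bounded_forward (fun t => pM (x t) j)
    & forall i j, (i, j) \in line G -> bounded_forward (fun t => eta (x t) i j)].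
Proof.
have [xs eqs] := equilibrium_exists G.
have V t : 0 <= t -> lyapunov xs (x t) <= lyapunov xs (x 0).
  by move=> t0; exact: lyapunov_nonincreasing.
split=> [j|j|i j ij].
- apply: (bounded_forward_weighted_sqr (M_gt0 G j)) => t t0.
  by have [h _ _] := lyapunov_coord xs (x t); exact: le_trans (h j) (V t t0).
- apply: (bounded_forward_weighted_sqr (divr_gt0 (tau_gt0 G j) (alpha_gt0 G j))) => t t0.
  by have [_ h _] := lyapunov_coord xs (x t); exact: le_trans (h j) (V t t0).
- apply: (bounded_forward_weighted_sqr (B_gt0 ij)) => t t0.
  by have [_ _ h] := lyapunov_coord xs (x t); exact: le_trans (h i j ij) (V t t0).
Qed.

Lemma net_power_bounded j : bounded_forward (fun t => net_power (x t) j).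
Proof.
have [bw bp be] := solution_bounded.
have : bounded_forward (fun t => - pL G j + pM (x t) j + - A G j * omega (x t) j
    + \sum_(p in line G) - (B G p.1 p.2 * ((p.1 == j)%:R - (p.2 == j)%:R)) *
        eta (x t) p.1 p.2).
  apply: bounded_forwardD; first apply: bounded_forwardD; first apply: bounded_forwardD.
  - exact: bounded_forward_cst.
  - exact: bp.
  - by apply: bounded_forwardM => //; exact: bounded_forward_cst.
  - apply: bounded_forward_sum => p hp; apply: bounded_forwardM.
      exact: bounded_forward_cst.
    by apply: be; rewrite -surjective_pairing.
move=> [K hK]; exists K => t /hK; rewrite /net_power outflowE; congr (`|_| <= _).
rewrite mulNr -[X in _ = _ - X]opprK -sumrN; congr (_ + _).
by rewrite opprK; apply: eq_bigr => p _; rewrite /flow; ring.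
Qed.

Lemma omega_lipschitz j : exists L, forall s t, 0 <= s -> s <= t ->
  `|omega (x t) j - omega (x s) j| <= L * (t - s).
Proof.
have [K hK] := net_power_bounded j.
(* The load may jump, but since [d_lo] and [d_hi] enclose both it and 0, its size is at most
   [d_hi - d_lo]. *)
exists ((M G j)^-1 * (K + (d_hi G j - d_lo G j))) => s t s0 st.
apply: (increment_norm_le solx s0 st (omega_ac solx t j)).
move=> r dx /andP[sr rt] [Qr dw _ _]; exists (omega dx j) => //.
have [v Fv ->] := Q_omega j Qr; have := filippov_load_bounded Fv.
have := hK r (le_trans s0 sr); have := (d_lo_le0 G j, d_hi_ge0 G j).
rewrite normrM gtr0_norm ?invr_gt0 ?M_gt0// => -[d1 d2] hr dv.
apply: ler_wpM2l; first by rewrite invr_ge0 ltW ?M_gt0.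
have -> : - pL G j + pM (x r) j - A G j * omega (x r) j - v - outflow G (flow (x r)) j =
  net_power (x r) j - v by rewrite /net_power; ring.
by move: hr dv; rewrite !ler_norml; lra.
Qed.

Lemma pM_lipschitz j : exists L, forall s t, 0 <= s -> s <= t ->
  `|pM (x t) j - pM (x s) j| <= L * (t - s).
Proof.
have [bw bp _] := solution_bounded.
have [K hK] := bounded_forwardD (bp j)
  (bounded_forwardM (bounded_forward_cst (alpha G j)) (bw j)).
exists ((tau G j)^-1 * K) => s t s0 st.
apply: (increment_norm_le solx s0 st (pM_ac solx t j)).
move=> r dx /andP[sr rt] [[_ _ Qp] _ dp _]; exists (pM dx j) => //.
rewrite Qp mulNr normrN normrM gtr0_norm ?invr_gt0 ?tau_gt0//.
by rewrite ler_wpM2l ?invr_ge0 ?(ltW (tau_gt0 G j))// hK// (le_trans s0).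
Qed.

Lemma omega_cvg xs j : equilibrium xs -> omega (x t) j @[t --> +oo] --> omega xs j.
Proof.
move=> eqs; have [L hL] := omega_lipschitz j; apply/subr_cvg0.
apply: (@barbalat _ (fun t => lyapunov xs (x t)) _ (A G j *+ 2) L).
- by move=> t _; exact: lyapunov_ge0.
- by rewrite pmulrn_lgt0 ?A_gt0.
- move=> s t c s0 st c0 hc.
  rewrite (_ : A G j *+ 2 * c = (A G j * c) *+ 2); last by rewrite mulrnAl.
  apply: lyapunov_increment => // r sr.
  have [h _] := dissipation_coord xs (x r); apply: le_trans (h j).
  by rewrite ler_wpM2l ?(ltW (A_gt0 G j))// hc.
- by move=> s t s0 st; rewrite opprD addrACA subrr addr0 hL.
Qed.

Lemma pM_cvg xs j : equilibrium xs -> pM (x t) j @[t --> +oo] --> pM xs j.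
Proof.
move=> eqs; have [L hL] := pM_lipschitz j; apply/subr_cvg0.
have a0 : 0 < (alpha G j)^-1 by rewrite invr_gt0 alpha_gt0.
apply: (@barbalat _ (fun t => lyapunov xs (x t)) _ ((alpha G j)^-1 *+ 2) L).
- by move=> t _; exact: lyapunov_ge0.
- by rewrite pmulrn_lgt0.
- move=> s t c s0 st c0 hc.
  rewrite (_ : (alpha G j)^-1 *+ 2 * c = ((alpha G j)^-1 * c) *+ 2); last by rewrite mulrnAl.
  apply: lyapunov_increment => // r sr.
  have [_ h] := dissipation_coord xs (x r); apply: le_trans (h j).
  by rewrite ler_wpM2l ?(ltW a0)// hc.
- by move=> s t s0 st; rewrite opprD addrACA subrr addr0 hL.
Qed.
End Convergence.

(** * Limit points *)

Section LimitPoint.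
Context {R : realType} {n : nat} {G : power_network R n}.
Variables (x : R -> state G) (solx : filippov_solution x) (xb : state G).
Hypothesis omega_sync : forall i j, (i, j) \in line G -> omega xb i = omega xb j.
Hypothesis omega_lim : forall j, omega (x t) j @[t --> +oo] --> omega xb j.
Hypothesis pM_lim : forall j, pM (x t) j @[t --> +oo] --> pM xb j.
Hypothesis eta_cluster : forall e T : R, 0 < e -> exists2 t, T <= t &
  forall i j, (i, j) \in line G -> `|eta (x t) i j - eta xb i j| <= e.

Lemma eventually_close (e : R) : 0 < e -> exists2 T, 0 <= T &
  forall t, T <= t -> forall j,
    `|omega (x t) j - omega xb j| <= e /\ `|pM (x t) j - pM xb j| <= e.
Proof.
move=> e0; have H : \forall t \near +oo, forall j,
    `|omega (x t) j - omega xb j| <= e /\ `|pM (x t) j - pM xb j| <= e.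
  apply: filter_forall => j; near=> t; split; rewrite distrC; near: t.
    by move/cvgrPdist_le : (@omega_lim j); apply.
  by move/cvgrPdist_le : (@pM_lim j); apply.
have [T [_ TP]] := H; exists (`|T| + 1) => [|t Tt]; first by rewrite addr_ge0.
by apply: TP; apply: lt_le_trans Tt; rewrite ltr_pwDr// ler_norm.
Unshelve. all: by end_near.
Qed.

(** Nearly equal frequencies at both ends of a line make its flow nearly stationary. Closeness of
    [eta] to the cluster point at one instant thus persists for a unit of time. *)
Lemma eta_drift (e T : R) : 0 <= T ->
  (forall t, T <= t -> forall j, `|omega (x t) j - omega xb j| <= e) ->
  forall s t i j, T <= s -> s <= t -> (i, j) \in line G ->
    `|eta (x t) i j - eta (x s) i j| <= (e *+ 2) * (t - s).
Proof.
move=> T0 we s t i j Ts st ij.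
apply: (increment_norm_le solx (le_trans T0 Ts) st (eta_ac solx t i j)).
move=> r dx /andP[sr rt] [[Qe _ _] _ _ de]; exists (eta dx i j); first exact: de.
have Tr := le_trans Ts sr; rewrite (Qe _ _ ij).
have := we r Tr i; have := we r Tr j; rewrite (omega_sync ij).
by rewrite !ler_norml mulr2n; lra.
Qed.

(* If the net power at [j] stayed away from the admissible loads, the frequency
   at [j] would keep drifting during a unit of time, whereas it converges. *)
Lemma no_drift j (sg e : R) : `|sg| = 1 -> 0 < e ->
  ~ (forall v, filippov_load G j (omega xb j) v -> e <= sg * (net_power xb j - v)).
Proof.
move=> sg1 e0 h; have [d d0 dP] := filippov_load_near G j (omega xb j).
have [K K0 KP] := net_power_dist (G := G) j.
have M0 := M_gt0 G j.
have D0 : 0 < K *+ 6 + M G j *+ 8 by rewrite addr_gt0// pmulrn_lgt0.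
(* With [c < d], loads met along the window are admissible at [xb]. The state stays within [3c] of
   [xb] (for [eta]: [c] at time [t] plus a drift of [2c]), so [6cK <= e] leaves a rate of at least
   [e / 2] for [sg * M * omega]. But [omega] moves by at most [2c], which contradicts [8cM <= e]. *)
pose c := Num.min (d / 2) (e / (K *+ 6 + M G j *+ 8)).
have c0 : 0 < c by rewrite lt_min !divr_gt0.
have cd : c < d.
  by rewrite gt_min; apply/orP; left; rewrite ltr_pdivrMr// ltr_pMr// ltr1n.
have ce : c * (K *+ 6 + M G j *+ 8) <= e.
  by rewrite -ler_pdivlMr// ge_min lexx orbT.
have cK : 0 < c * K by exact: mulr_gt0.
have cM : 0 < c * M G j by exact: mulr_gt0.
have [T T0 TP] := eventually_close c0.
have [t Tt et] := eta_cluster T c0.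
have t0 := le_trans T0 Tt; have tt : t <= t + 1 by rewrite lerDl.
have close r : t <= r <= t + 1 -> `|net_power (x r) j - net_power xb j| <= K * (c *+ 3).
  move=> /andP[tr rt]; have [wr pr] := TP r (le_trans Tt tr) j.
  apply: KP => [||a b ab].
  - by apply: le_trans wr _; lra.
  - by apply: le_trans pr _; lra.
  have h1 := et a b ab.
  have h2 := eta_drift T0 (fun t Tt j => (TP t Tt j).1) Tt tr ab.
  have h3 : c *+ 2 * (r - t) <= c *+ 2
    by apply: ler_piMr; [rewrite mulrn_wge0// ltW|move: tr rt; lra].
  have := ler_normD (eta (x r) a b - eta (x t) a b) (eta (x t) a b - eta xb a b).
  by rewrite addrA subrK; lra.
have := @increment_le _ _ _ _ solx (fun r => - (sg * M G j) * omega (x r) j)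
  t (t + 1) (- (e / 2)) t0 tt.
move=> /(_ _ _)/wrap[]; first by apply: acM; [exact: ac_cst|exact: omega_ac].
  move=> r dx tr [Qr dw _ _].
  exists (- (sg * M G j) * omega dx j); first exact: (is_deriveZ _ (dw j)).
  have [v Fv ->] := Q_omega j Qr.
  have /h hv : filippov_load G j (omega xb j) v.
    apply: dP Fv; apply: le_lt_trans cd.
    by have [] := TP r (le_trans Tt (proj1 (andP tr))) j.
  have -> : - (sg * M G j) * ((M G j)^-1 * (- pL G j + pM (x r) j
      - A G j * omega (x r) j - v - outflow G (flow (x r)) j)) =
      - (sg * (net_power xb j - v)) - sg * (net_power (x r) j - net_power xb j).
    by rewrite /net_power; field; rewrite gt_eqF.
  have := ler_norm (- (sg * (net_power (x r) j - net_power xb j))).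
  rewrite normrN normrM sg1 mul1r => h1.
  have := close r tr.
  by lra.
rewrite addrAC subrr add0r mulr1 => h1.
have [w1 _] := TP t Tt j; have [w2 _] := TP (t + 1) (le_trans Tt tt) j.
have w3 : `|omega (x (t + 1)) j - omega (x t) j| <= c *+ 2.
  by move: w1 w2; rewrite !ler_norml mulr2n; lra.
have := ler_norm (sg * M G j * (omega (x (t + 1)) j - omega (x t) j)).
rewrite !normrM sg1 mul1r gtr0_norm// => h2.
have := ler_wpM2l (ltW M0) w3.
lra.
Qed.

(** The load needed for balance is [net_power] itself. The admissible loads form a closed interval,
    so if it lay outside, it would be separated from all of them by a fixed gap on one side; [sg]
    selects the side. *)
Lemma limit_point_equilibrium :
  (forall j, pM xb j + alpha G j * omega xb j = 0) -> equilibrium xb.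
Proof.
move=> pb; apply/equilibriumP; split=> // j.
exists (net_power xb j); last by rewrite /net_power; ring.
rewrite filippov_loadE; apply/andP; split; rewrite leNgt; apply/negP => lt.
- apply: (@no_drift j (-1) (load_min G j (omega xb j) - net_power xb j)).
  + by rewrite normrN normr1.
  + by rewrite subr_gt0.
  + by move=> v; rewrite filippov_loadE => /andP[? ?]; lra.
- apply: (@no_drift j 1 (net_power xb j - load_max G j (omega xb j))).
  + by rewrite normr1.
  + by rewrite subr_gt0.
  + by move=> v; rewrite filippov_loadE => /andP[? ?]; lra.
Qed.

Lemma limit_point_cvg : equilibrium xb -> x t @[t --> +oo] --> xb.
Proof.
move=> eqb; apply/cvgrPdist_le => e e0.
have [T0 T00 T0P] := eventually_close e0.
have etaP (p : 'I_n * 'I_n) : \forall t \near +oo, p \in line G ->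
    `|eta (x t) p.1 p.2 - eta xb p.1 p.2| <= e.
  have [hp|_] := boolP (p \in line G); last exact: nearW.
  have hp' : (p.1, p.2) \in line G by rewrite -surjective_pairing.
  have Bp := B_gt0 hp'.
  have [K K0 KP] := lyapunov_small xb.
  (* The cap at 1 gives [c ^+ 2 <= c], so no square root is needed to make [K * c ^+ 2] small. *)
  pose c := Num.min 1 (B G p.1 p.2 * e ^+ 2 / K).
  have c0 : 0 < c by rewrite lt_min ltr01 divr_gt0// mulr_gt0// exprn_gt0.
  have Kc : K * c ^+ 2 <= B G p.1 p.2 * e ^+ 2.
    rewrite mulrC -ler_pdivlMr//; apply: (@le_trans _ _ c).
      by rewrite expr2; apply: ler_piMr; [exact: ltW|rewrite ge_min lexx].
    by rewrite ge_min lexx orbT.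
  have [T TT TP] := eventually_close c0.
  have [s Ts es] := eta_cluster T c0.
  have Vs : lyapunov xb (x s) <= B G p.1 p.2 * e ^+ 2.
    by apply: le_trans Kc; apply: KP => // j; have [] := TP s Ts j.
  have : \forall t \near +oo, s <= t by apply: nbhs_pinfty_ge; rewrite num_real.
  apply: filterS => t st _.
  have [_ _ /(_ _ _ hp') h] := lyapunov_coord xb (x t).
  have Vt := lyapunov_nonincreasing solx eqb (le_trans TT Ts) st.
  have := le_trans h (le_trans Vt Vs); rewrite ler_pM2l//.
  by rewrite -real_normK ?num_real// ler_sqr ?nnegrE// ltW.
have : \forall t \near +oo, forall p, p \in line G ->
    `|eta (x t) p.1 p.2 - eta xb p.1 p.2| <= e by exact: filter_forall.
have : \forall t \near +oo, T0 <= t by apply: nbhs_pinfty_ge; rewrite num_real.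
apply: filterS2 => t /T0P T0t et; rewrite distrC; apply: state_norm_le.
- exact: ltW.
- by move=> i j ij; rewrite etaB; exact: et (i, j) ij.
- by move=> j; rewrite omegaB; have [] := T0t j.
- by move=> j; rewrite pMB; have [] := T0t j.
Qed.

End LimitPoint.

(** * The limit assembled from an equilibrium and a cluster point of the flows *)

Theorem theorem1 (R : realType) (n : nat) (G : power_network R n)
  (x0 : state G) (x : R -> state G) :
  filippov_solution x -> x 0 = x0 ->
  exists2 xstar : state G, equilibrium xstar & x t @[t --> +oo] --> xstar.
Proof.
move=> solx _; have [xs eqs] := equilibrium_exists G.
have [_ _ be] := solution_bounded solx.
have [K hK] : bounded_forward (fun t => `|(x t).1.1|).
  have [K hK] : bounded_forward (fun t => \sum_(p in line G) `|eta (x t) p.1 p.2|).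
    apply: bounded_forward_sum => p hp; have [|K hK] := be p.1 p.2.
      by rewrite -surjective_pairing.
    by exists K => t t0; rewrite normr_id hK.
  exists K => t /hK; rewrite normr_id; apply: le_trans.
  apply: row_norm_le => // l; apply: le_trans (ler_norm _).
  rewrite -at_line_enum_val (bigD1 (enum_val l)) ?enum_valP//= lerDl.
  exact: sumr_ge0.
(* The same times must serve all lines at once, hence a cluster point of the whole row rather than
   one per line. *)
have [l ll] : exists l, forall e T, 0 < e ->
    exists2 t, T <= t & `|l - (x t).1.1| < e.
  by apply: (@bounded_row_cluster _ _ (fun t => (x t).1.1) K) => t /hK; rewrite normr_id.
(* Frequencies and mechanical powers may be taken from the arbitrary [xs], since those of the
   solution converge to them. *)
pose xb : state G := (l, xs.1.2, xs.2).
have [sync _ pb] := (equilibriumP xs).1 eqs.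
have wl j : omega (x t) j @[t --> +oo] --> omega xb j by exact: (omega_cvg solx (j := j) eqs).
have pl j : pM (x t) j @[t --> +oo] --> pM xb j by exact: (pM_cvg solx (j := j) eqs).
have cl (e T : R) : 0 < e -> exists2 t, T <= t &
    forall i j, (i, j) \in line G -> `|eta (x t) i j - eta xb i j| <= e.
  move=> e0; have [t Tt lt] := ll e T e0; exists t => // i j ij.
  have := at_line_enum_val ((x t).1.1 - l) (enum_rank_in ij (i, j)).
  rewrite enum_rankK_in//= /eta -at_lineB => ->.
  by rewrite (le_trans (row_norm_coord _ _))// distrC ltW.
have eqb : equilibrium xb.
  exact: (@limit_point_equilibrium _ _ _ x solx xb sync wl pl cl pb).
by exists xb => //; exact: (@limit_point_cvg _ _ _ x solx xb wl pl cl eqb).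
Qed.
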